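(* Let $\nu\in\mathbb{N}$ be the value used in Algorithm 1 and suppose that the operator $F_\nu$ is strongly monotone on $\mathcal{X}$ with constant $\alpha_\nu>0$ and Lipschitz with constant $L_\nu>0$. Let the step size satisfy $$\tau<\frac{-L_\nu^2+\sqrt{L_\nu^4+4\alpha_\nu^2\|A_\nu\|^2}}{2\alpha_\nu\|A_\nu\|^2},$$ where $\|A_\nu\|$ is the induced 2-norm. Then for every initial condition $(x_{(0)},\lambda_{(0)})\in\mathcal{X}\times\mathbb{R}^{Nm}_{\ge0}$ the sequence $(x_{(k)})_{k=1}^\infty$ produced by Algorithm 1 converges to the unique variational Nash equilibrium of $\mathcal{G}_\nu$.
   Context: Let $N,n,m$ be positive integers; for each $i\in\{1,\dots,N\}$, $\mathcal{X}^i\subset\mathbb{R}^n$ is convex, compact, with non-empty interior; $\mathcal{X}=\mathcal{X}^1\times\dots\times\mathcal{X}^N$, $x=[x^1;\dots;x^N]$. Each agent has a cost $J^i(z_1,z_2):\mathcal{X}^i\times\mathrm{conv}(\mathcal{X}^1,\dots,\mathcal{X}^N)\to\mathbb{R}$ continuously differentiable in $(z_1,z_2)$, with $x^i\mapsto J^i(x^i,\frac1N\sum_j x^j)$ convex for every fixed $x^{-i}$. Let $\hat A\in\mathbb{R}^{m\times n}$, $\hat b\in\mathbb{R}^m$, $T\in[0,1]^{N\times N}$ (communication matrix), $\mathcal{N}^i_{\rm in}=\{j:T_{ij}>0\}$, $\mathcal{N}^i_{\rm out}=\{j:T_{ji}>0\}$. Game $\mathcal{G}_\nu$: $\sigma^i_\nu(x)=\sum_j[T^\nu]_{ij}x^j$;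 $A_\nu=T^\nu\otimes\hat A$, $b=\mathbf{1}_N\otimes\hat b$; $\mathcal{Q}_\nu=\{x\in\mathcal{X}:A_\nu x\le b\}$, $\mathcal{Q}^i_\nu(x^{-i})=\{x^i\in\mathcal{X}^i:A_\nu x\le b\}$; agent $i$ minimizes $J^i(x^i,\sigma^i_\nu(x))$ over $\mathcal{Q}^i_\nu(x^{-i})$. $F_\nu(x)=[\nabla_{z_1}J^i(x^i,\sigma^i_\nu(x))+[T^\nu]_{ii}\nabla_{z_2}J^i(x^i,\sigma^i_\nu(x))]_{i=1}^N$. A variational Nash equilibrium of $\mathcal{G}_\nu$ is a point $\bar x\in\mathcal{Q}_\nu$ with $F_\nu(\bar x)^\top(x-\bar x)\ge0$ for all $x\in\mathcal{Q}_\nu$. Strongly monotone with constant $\alpha$: $(F(x)-F(y))^\top(x-y)\ge\alpha\|x-y\|^2$ for all $x,y$. Algorithm 1 (parameters $\tau>0$, $\nu$): initialize $x^i_{(0)}\in\mathcal{X}^i$, $\lambda^i_{(0)}\in\mathbb{R}^m_{\ge0}$, $\sigma^i_{\nu,(0)}=x^i_{(0)}$. At iteration $k$, for all $i$: $\mu^i_{\nu,(k)}\leftarrow\lambda^i_{(k)}$ then $\nu$ times $\mu^i_{\nu,(k)}\leftarrow\sum_{j\in\mathcal{N}^i_{\rm out}}T_{ji}\mu^j_{\nu,(k)}$; $F^i_{\nu,(k)}=\nabla_{z_1}J^i(x^i_{(k)},\sigma^i_{\nu,(k)})+[T^\nu]_{ii}\nabla_{z_2}J^i(x^i_{(k)},\sigma^i_{\nu,(k)})$;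 $x^i_{(k+1)}=\Pi_{\mathcal{X}^i}[x^i_{(k)}-\tau(F^i_{\nu,(k)}+\hat A^\top\mu^i_{\nu,(k)})]$; $\sigma^i_{\nu,(k+1)}\leftarrow x^i_{(k+1)}$ then $\nu$ times $\sigma^i_{\nu,(k+1)}\leftarrow\sum_{j\in\mathcal{N}^i_{\rm in}}T_{ij}\sigma^j_{\nu,(k+1)}$; $\lambda^i_{(k+1)}=\Pi_{\mathbb{R}^m_{\ge0}}[\lambda^i_{(k)}-\tau(\hat b-2\hat A\sigma^i_{\nu,(k+1)}+\hat A\sigma^i_{\nu,(k)})]$. $\Pi_S$ is Euclidean projection onto $S$; $x_{(k)}=[x^1_{(k)};\dots;x^N_{(k)}]$.
   Formalization: The formal statement additionally assumes that the feasible set Q_ν is non-empty, since otherwise no variational Nash equilibrium exists; when ‖A_ν‖ = 0 the step-size bound is undefined and the formal statement is vacuous. *)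

(* Defs.v *)
From HB Require Import structures.
From mathcomp Require Import all_boot all_order all_algebra.
From mathcomp Require Import all_classical all_reals all_analysis.
Set Implicit Arguments.
Unset Strict Implicit.
Unset Printing Implicit Defensive.
Import Order.TTheory GRing.Theory Num.Theory.
Import numFieldNormedType.Exports.
Local Open Scope classical_set_scope.
Local Open Scope ring_scope.

Section Defs.
Variable R : realType.

Definition vdot (n : nat) (u v : 'cV[R]_n) : R := \sum_(k < n) u k 0 * v k 0.
Definition vnorm (n : nat) (u : 'cV[R]_n) : R := Num.sqrt (vdot u u).

(** Stacked vectors x = [x^1; ...; x^N] with x^i in R^n, represented blockwise. *)
Definition sdot (N n : nat) (x y : 'I_N -> 'cV[R]_n) : R :=
  \sum_(i < N) vdot (x i) (y i).
Definition snorm (N n : nat) (x : 'I_N -> 'cV[R]_n) : R := Num.sqrt (sdot x x).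
Definition ssub (N n : nat) (x y : 'I_N -> 'cV[R]_n) : 'I_N -> 'cV[R]_n :=
  fun i => x i - y i.

(** Matrix power T^k (for arbitrary N, where 'M_N need not be a ring). *)
Definition mxpow (N : nat) (T : 'M[R]_N) (k : nat) : 'M[R]_N :=
  iter k (fun M => M *m T) 1%:M.

Definition vle (m : nat) (u v : 'cV[R]_m) : Prop := forall k, u k 0 <= v k 0.
Definition nonneg_orthant (m : nat) : set 'cV[R]_m := [set u | vle 0 u].

Definition conv_hull (N n : nat) (X : 'I_N -> set 'cV[R]_n) : set 'cV[R]_n :=
  [set z | exists (p : nat) (t : 'I_p -> R) (y : 'I_p -> 'cV[R]_n),
      (forall k, 0 <= t k) /\ \sum_(k < p) t k = 1 /\
      (forall k, exists i, X i (y k)) /\ z = \sum_(k < p) t k *: y k].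

Definition is_proj (n : nat) (S : set 'cV[R]_n) (z p : 'cV[R]_n) : Prop :=
  S p /\ forall y, S y -> vnorm (p - z) <= vnorm (y - z).

Definition C1_on_with_grads (n : nat) (D : set ('cV[R]_n * 'cV[R]_n))
    (f : 'cV[R]_n -> 'cV[R]_n -> R) (g1 g2 : 'cV[R]_n -> 'cV[R]_n -> 'cV[R]_n) : Prop :=
  (forall z1 z2, D (z1, z2) -> forall e : R, 0 < e -> exists d : R, 0 < d /\
     forall h1 h2, D (z1 + h1, z2 + h2) -> vnorm h1 + vnorm h2 < d ->
       `| f (z1 + h1) (z2 + h2) - f z1 z2 - (vdot (g1 z1 z2) h1 + vdot (g2 z1 z2) h2) |
         <= e * (vnorm h1 + vnorm h2)) /\
  (forall z1 z2, D (z1, z2) -> forall e : R, 0 < e -> exists d : R, 0 < d /\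
     forall w1 w2, D (w1, w2) -> vnorm (w1 - z1) + vnorm (w2 - z2) < d ->
       vnorm (g1 w1 w2 - g1 z1 z2) + vnorm (g2 w1 w2 - g2 z1 z2) < e).

Definition sigma_nu (N n : nat) (T : 'M[R]_N) (nu : nat) (x : 'I_N -> 'cV[R]_n)
  : 'I_N -> 'cV[R]_n :=
  fun i => \sum_(j < N) mxpow T nu i j *: x j.

(** A_nu x = (T^nu \otimes Ahat) x, blockwise. *)
Definition A_nu (N n m : nat) (T : 'M[R]_N) (nu : nat) (Ahat : 'M[R]_(m, n))
    (x : 'I_N -> 'cV[R]_n) : 'I_N -> 'cV[R]_m :=
  fun i => \sum_(j < N) mxpow T nu i j *: (Ahat *m x j).

Definition A_nu_norm (N n m : nat) (T : 'M[R]_N) (nu : nat) (Ahat : 'M[R]_(m, n)) : R :=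
  sup [set r | exists x : 'I_N -> 'cV[R]_n, snorm x <= 1 /\ r = snorm (A_nu T nu Ahat x)].

Definition F_nu (N n : nat) (T : 'M[R]_N) (nu : nat)
    (g1 g2 : 'I_N -> 'cV[R]_n -> 'cV[R]_n -> 'cV[R]_n) (x : 'I_N -> 'cV[R]_n)
  : 'I_N -> 'cV[R]_n :=
  fun i => g1 i (x i) (sigma_nu T nu x i) + mxpow T nu i i *: g2 i (x i) (sigma_nu T nu x i).

Definition in_prod (N n : nat) (X : 'I_N -> set 'cV[R]_n) (x : 'I_N -> 'cV[R]_n) : Prop :=
  forall i, X i (x i).

(** Q_nu = {x in X : A_nu x <= b}, with b = 1_N \otimes bhat. *)
Definition Q_nu (N n m : nat) (X : 'I_N -> set 'cV[R]_n) (T : 'M[R]_N) (nu : nat)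
    (Ahat : 'M[R]_(m, n)) (bhat : 'cV[R]_m) : set ('I_N -> 'cV[R]_n) :=
  [set x | in_prod X x /\ forall i, vle (A_nu T nu Ahat x i) bhat].

Definition is_VNE (N n m : nat) (X : 'I_N -> set 'cV[R]_n) (T : 'M[R]_N) (nu : nat)
    (Ahat : 'M[R]_(m, n)) (bhat : 'cV[R]_m)
    (g1 g2 : 'I_N -> 'cV[R]_n -> 'cV[R]_n -> 'cV[R]_n) (xb : 'I_N -> 'cV[R]_n) : Prop :=
  Q_nu X T nu Ahat bhat xb /\
  forall x, Q_nu X T nu Ahat bhat x -> 0 <= sdot (F_nu T nu g1 g2 xb) (ssub x xb).

(** Communication steps of Algorithm 1 (sums over neighbours = sums over all j,
    since T_ij = 0 for non-neighbours). *)
Definition mix_in (N p : nat) (T : 'M[R]_N) (s : 'I_N -> 'cV[R]_p) : 'I_N -> 'cV[R]_p :=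
  fun i => \sum_(j < N) T i j *: s j.
Definition mix_out (N p : nat) (T : 'M[R]_N) (s : 'I_N -> 'cV[R]_p) : 'I_N -> 'cV[R]_p :=
  fun i => \sum_(j < N) T j i *: s j.

Definition alg_sigma (N n : nat) (T : 'M[R]_N) (nu : nat) (x : nat -> 'I_N -> 'cV[R]_n)
    (k : nat) : 'I_N -> 'cV[R]_n :=
  if k is k'.+1 then iter nu (mix_in T) (x k) else x 0%N.

Definition alg_mu (N m : nat) (T : 'M[R]_N) (nu : nat) (lam : nat -> 'I_N -> 'cV[R]_m)
    (k : nat) : 'I_N -> 'cV[R]_m :=
  iter nu (mix_out T) (lam k).

Definition Alg1_run (N n m : nat) (X : 'I_N -> set 'cV[R]_n) (T : 'M[R]_N) (nu : nat)
    (Ahat : 'M[R]_(m, n)) (bhat : 'cV[R]_m)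
    (g1 g2 : 'I_N -> 'cV[R]_n -> 'cV[R]_n -> 'cV[R]_n) (tau : R)
    (x : nat -> 'I_N -> 'cV[R]_n) (lam : nat -> 'I_N -> 'cV[R]_m) : Prop :=
  forall (k : nat) (i : 'I_N), and
    (is_proj (X i)
      (x k i - tau *: (g1 i (x k i) (alg_sigma T nu x k i)
                        + mxpow T nu i i *: g2 i (x k i) (alg_sigma T nu x k i)
                        + Ahat^T *m alg_mu T nu lam k i))
      (x k.+1 i))
    (is_proj (@nonneg_orthant m)
      (lam k i - tau *: (bhat - 2%:R *: (Ahat *m alg_sigma T nu x k.+1 i)
                              + Ahat *m alg_sigma T nu x k i))
      (lam k.+1 i)).

End Defs.

(* Main.v *)
Require Import Defs.
From HB Require Import structures.
From mathcomp Require Import all_boot all_order all_algebra.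
From mathcomp Require Import ring lra.
From mathcomp Require Import all_classical all_reals all_analysis.
Set Implicit Arguments.
Unset Strict Implicit.
Unset Printing Implicit Defensive.
Import Order.TTheory GRing.Theory Num.Theory.
Import numFieldNormedType.Exports.
Local Open Scope classical_set_scope.
Local Open Scope ring_scope.

(** The sets X^i need not be polyhedral and no Slater condition is assumed, so
    the equilibrium xb may have no Lagrange multiplier and lambda_k may be
    unbounded; the usual Fejer argument around a primal-dual solution is not
    available. Instead put u_k = x_{k+1} - x_k, v_k = lambda_{k+1} - lambda_k and
    measure (u_k, v_k) in the norm of the preconditioner [[1/tau, -A^T], [-A, 1/tau]],
    whose square is
      s_k^2 = (|u_k|^2 + |v_k|^2) / tau - 2 <A u_k, v_k>.
    Under the step size condition s_{k+1}^2 <= s_k^2 - alpha |u_k|^2. With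
      q_k = <lambda_k, A x_k - b> + <F xb, x_k - xb>,
    summation by parts bounds (k+1)^2 s_{k+1}^2 - c (2k+1) q_{k+1} + c' |lambda_k|^2
    by a potential whose increments are at most - G <F xb, x_{k+1} - xb> + B s_k.
    This first gives s_k^2 = O(1/k) and |lambda_k|^2 = O(k). So the constraints hold
    in the limit, the limit inferior of <F xb, x_k - xb> is nonnegative, and the
    same potential now gives s_k^2 = o(1/k). Hence <lambda_k, v_k> -> 0, and strong
    monotonicity forces x_k -> xb. *)

(** * Convergence from the energy inequalities *)

Section EnergyInequalities.
Variables (R : realType) (alpha tau C : R) (s un vn xt Lam la f : nat -> R).
Hypotheses (alpha0 : 0 < alpha) (tau0 : 0 < tau) (C0 : 0 < C).
Hypothesis s0 : forall k, 0 <= s k.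
Hypothesis un0 : forall k, 0 <= un k.
Hypothesis vn0 : forall k, 0 <= vn k.
Hypothesis xt0 : forall k, 0 <= xt k.
Hypothesis Lam0 : forall k, 0 <= Lam k.
Hypothesis s_decr : forall k, s k.+1 ^+ 2 <= s k ^+ 2 - alpha * un k ^+ 2.
Hypothesis un_le : forall k, un k <= C * s k.
Hypothesis vn_le : forall k, vn k <= C * s k.
Hypothesis s_le : forall k, s k ^+ 2 <= C * (un k ^+ 2 + vn k ^+ 2).
Hypothesis vn_telescope : forall k, vn k.+1 ^+ 2 <=
  tau * (la k.+2 + f k.+2 - (la k.+1 + f k.+1)) +
  C * (un k.+1 * (xt k + un k + vn k + vn k.+1)).
Hypothesis xt_le : forall k,
  alpha * xt k ^+ 2 <= - (la k.+1 + f k.+1) + C * (un k + vn k).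
Hypothesis Lam_le : forall k,
  Lam k.+1 ^+ 2 - Lam k ^+ 2 <= 2 * tau * la k.+1 + C * un k.
Hypothesis la_ge : forall k, - la k.+1 <= C * (Lam k.+1 * vn k + un k).
Hypothesis f_liminf : forall e, 0 < e -> exists2 d, 0 < d &
  forall k, s k <= d -> - e <= f k.+1.
Hypothesis f_bound : forall k, - C <= f k.

Let s_noninc k : s k.+1 <= s k.
Proof.
rewrite -(@ler_pXn2r _ 2) ?nnegrE//.
by apply: le_trans (s_decr k) _; rewrite lerBlDr lerDl mulr_ge0 ?sqr_ge0 ?ltW.
Qed.

Let s_le0 k : s k <= s 0%N.
Proof. by elim: k => // k IH; apply: le_trans IH. Qed.

Let q k := la k + f k.
Let B1 := C ^+ 2 + 3 * C ^+ 3.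
Let B2 := 2 * B1 ^+ 2 / alpha.
Let G := 2 * tau * C + B2 / alpha.
Let C1 := G / (2 * tau).
Let B3 := 2 * C ^+ 2 * B2 / alpha + B2 * s 0%N + C1 * C ^+ 2.
Let P k : R := k.+1%:R ^+ 2 * s k.+1 ^+ 2 - tau * C * (2 * k%:R + 1) * q k.+1
  + C1 * Lam k ^+ 2.

Let B2_gt0 : 0 < B2.
Proof.
apply: divr_gt0 => //; rewrite mulr_gt0 ?exprn_gt0// /B1.
by rewrite addr_gt0 ?mulr_gt0 ?exprn_gt0.
Qed.
Let G_gt0 : 0 < G.
Proof. by apply: addr_gt0; [rewrite !mulr_gt0 | exact: divr_gt0]. Qed.
Let C1_gt0 : 0 < C1.
Proof. by apply: divr_gt0 => //; rewrite mulr_gt0. Qed.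
Let B3_ge0 : 0 <= B3.
Proof.
have := ltW B2_gt0; have := ltW C1_gt0; have := ltW alpha0 => a1 a2 a3.
apply: addr_ge0; last by apply: mulr_ge0; rewrite ?sqr_ge0.
apply: addr_ge0; last exact: mulr_ge0.
by apply: divr_ge0 => //; apply: mulr_ge0 => //; apply: mulr_ge0; rewrite ?sqr_ge0.
Qed.

Let q_le k : q k.+1 <= 2 * C ^+ 2 * s k.
Proof.
have h := xt_le k; have := mulr_ge0 (ltW alpha0) (sqr_ge0 (xt k)).
have h1 := ler_wpM2l (ltW C0) (un_le k); have h2 := ler_wpM2l (ltW C0) (vn_le k).
rewrite /q; lra.
Qed.

Let potential_step k : P k.+1 - P k <= - G * f k.+1 + B3 * s k.
Proof.
have kR0 : 0 <= k%:R :> R by rewrite ler0n.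
set t := (k%:R + 2) * un k.+1.
set Z := C * un k.+1 + C ^+ 2 * (xt k + un k + vn k + vn k.+1).
have t0 : 0 <= t by rewrite mulr_ge0// addr_ge0.
have Z0 : 0 <= Z by rewrite /Z addr_ge0 ?mulr_ge0 ?sqr_ge0 ?addr_ge0 // ltW.
have ZB : Z <= B1 * (xt k + s k).
  have e1 : un k.+1 <= C * s k.
    by apply: le_trans (un_le _) _; rewrite ler_pM2l.
  have e2 : vn k.+1 <= C * s k.
    by apply: le_trans (vn_le _) _; rewrite ler_pM2l.
  have e3 := ler_wpM2l (ltW C0) e1.
  have e4 : C ^+ 2 * (xt k + un k + vn k + vn k.+1) <= C ^+ 2 * (xt k + 3 * C * s k).
    by rewrite ler_wpM2l ?sqr_ge0//; have := un_le k; have := vn_le k; lra.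
  have e5 : 0 <= C ^+ 3 * xt k.
    by rewrite mulr_ge0 ?exprn_ge0 // ltW.
  rewrite /Z /B1; lra.
have cross : 2 * t * Z - alpha * t ^+ 2 <= B2 * (xt k ^+ 2 + s k ^+ 2).
  have f1 : 2 * t * Z - alpha * t ^+ 2 <= Z ^+ 2 / alpha.
    rewrite ler_pdivlMr// -subr_ge0.
    have -> : Z ^+ 2 - (2 * t * Z - alpha * t ^+ 2) * alpha = (Z - alpha * t) ^+ 2.
      by ring.
    exact: sqr_ge0.
  apply: le_trans f1 _.
  have -> : B2 * (xt k ^+ 2 + s k ^+ 2) = B1 ^+ 2 * (2 * (xt k ^+ 2 + s k ^+ 2)) / alpha.
    by rewrite /B2; field; rewrite gt_eqF.
  rewrite ler_pM2r ?invr_gt0//.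
  have f2 : Z ^+ 2 <= (B1 * (xt k + s k)) ^+ 2.
    by rewrite ler_pXn2r ?nnegrE// (le_trans Z0).
  apply: le_trans f2 _; rewrite exprMn.
  rewrite ler_wpM2l ?sqr_ge0// -subr_ge0.
  have -> : 2 * (xt k ^+ 2 + s k ^+ 2) - (xt k + s k) ^+ 2 = (xt k - s k) ^+ 2 by ring.
  exact: sqr_ge0.
have ss : B2 * s k ^+ 2 <= B2 * (s 0%N * s k).
  by rewrite ler_pM2l// expr2 ler_wpM2r.
have sx : B2 * xt k ^+ 2 <= B2 / alpha * (- q k.+1 + 2 * C ^+ 2 * s k).
  rewrite -mulrA ler_pM2l// mulrC ler_pdivlMr// mulrC.
  apply: le_trans (xt_le k) _; rewrite lerD2l.
  have h1 := ler_wpM2l (ltW C0) (un_le k); have h2 := ler_wpM2l (ltW C0) (vn_le k).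
  by lra.
have sL : C1 * (Lam k.+1 ^+ 2 - Lam k ^+ 2) <= G * la k.+1 + C1 * C ^+ 2 * s k.
  apply: le_trans (ler_wpM2l (ltW C1_gt0) (Lam_le k)) _.
  rewrite mulrDr (_ : C1 * (2 * tau * la k.+1) = G * la k.+1); last first.
    by rewrite /C1; field; rewrite gt_eqF.
  rewrite lerD2l -mulrA ler_pM2l// expr2 -mulrA ler_pM2l//.
have d1 : k.+2%:R ^+ 2 * s k.+2 ^+ 2 <=
    (k%:R + 2) ^+ 2 * s k.+1 ^+ 2 - alpha * t ^+ 2.
  have -> : k.+2%:R = k%:R + 2 :> R by rewrite -natr1 -natr1; ring.
  have := ler_wpM2l (sqr_ge0 (k%:R + 2 : R)) (s_decr k.+1).
  by rewrite /t; lra.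
have d2 : (2 * k%:R + 3) * s k.+1 ^+ 2 <= 2 * t * Z
    + (2 * k%:R + 3) * (C * tau * (q k.+2 - q k.+1)).
  have k3 : 0 <= 2 * k%:R + 3 :> R by lra.
  have h1 : s k.+1 ^+ 2 <= un k.+1 * Z + C * tau * (q k.+2 - q k.+1).
    apply: le_trans (s_le _) _.
    have := ler_wpM2l (ltW C0) (vn_telescope k).
    rewrite /Z /q; lra.
  apply: le_trans (ler_wpM2l k3 h1) _; rewrite mulrDr lerD2r mulrA ler_wpM2r//.
  by rewrite /t; have := un0 k.+1; lra.
move: d1 d2 sL sx ss cross.
rewrite /P /B3 -!natr1 /G -![q _]/(la _ + f _).
set U := s k.+1 ^+ 2; set U2 := s k.+2 ^+ 2.
lra.
Qed.


Let potential_ge k : k.+1%:R ^+ 2 * s k.+1 ^+ 2 + C1 * Lam k ^+ 2 <=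
  P k + 4 * tau * C ^+ 3 * s k * k.+1%:R.
Proof.
have kR0 : 0 <= k%:R :> R by rewrite ler0n.
have [tW CW] := (ltW tau0, ltW C0).
have tC : 0 <= tau * C * (2 * k%:R + 1) by rewrite !mulr_ge0 ?addr_ge0 ?mulr_ge0.
have h := ler_wpM2l tC (q_le k).
have h2 : 0 <= tau * C ^+ 3 * s k by rewrite !mulr_ge0 ?exprn_ge0.
rewrite /P -natr1; lra.
Qed.

Let potential_affine K eta : (forall k, (K <= k)%N -> - G * f k.+1 + B3 * s k <= eta) ->
  forall k, P (K + k)%N <= P K + eta * k%:R.
Proof.
move=> h; elim => [|k IH]; first by rewrite addn0 mulr0 addr0.
have := potential_step (K + k); have := h (K + k)%N (leq_addr _ _).
by rewrite addnS -natr1; lra.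
Qed.

Let B4 := `|P 0%N| + G * C + B3 * s 0%N + 4 * tau * C ^+ 3 * s 0%N.

Let B4_ge0 : 0 <= B4.
Proof.
have [tW CW] := (ltW tau0, ltW C0).
apply: addr_ge0; last by rewrite !mulr_ge0 ?exprn_ge0.
apply: addr_ge0; last exact: mulr_ge0.
by apply: addr_ge0 => //; apply: mulr_ge0; apply: ltW.
Qed.

Let linear_growth k :
  k.+1%:R ^+ 2 * s k.+1 ^+ 2 + C1 * Lam k ^+ 2 <= B4 * k.+1%:R.
Proof.
have kR0 : 0 <= k%:R :> R by rewrite ler0n.
apply: le_trans (potential_ge k) _.
have h : forall j, (0 <= j)%N -> - G * f j.+1 + B3 * s j <= G * C + B3 * s 0%N.
  move=> j _; apply: lerD; last by rewrite ler_wpM2l.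
  by rewrite mulNr -mulrN ler_pM2l// lerNl.
have := potential_affine h k; rewrite add0n => hP.
have h1 : 4 * tau * C ^+ 3 * s k * k.+1%:R <= 4 * tau * C ^+ 3 * s 0%N * k.+1%:R.
  have [tW CW] := (ltW tau0, ltW C0).
  by rewrite ler_wpM2r// ler_wpM2l// !mulr_ge0 ?exprn_ge0.
have h2 := ler_norm (P 0%N).
have h3 : 0 <= `|P 0%N| * k%:R by rewrite mulr_ge0.
have h4 : 0 <= G * C + B3 * s 0%N.
  by apply: addr_ge0; apply: mulr_ge0 => //; apply: ltW.
move: hP h1 h2 h3 h4; rewrite /B4 -natr1; lra.
Qed.

Let s_small e : 0 < e -> exists K, forall k, (K <= k)%N -> s k <= e.
Proof.
move=> e0; have e20 : 0 < e ^+ 2 by rewrite exprn_gt0.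
exists (Num.trunc (B4 / e ^+ 2)).+1 => -[//|k] hk.
have eW := ltW e0; rewrite -(@ler_pXn2r _ 2) ?nnegrE//.
have k0 : 0 < k.+1%:R :> R by rewrite ltr0n.
have h1 : B4 < e ^+ 2 * k.+1%:R.
  rewrite mulrC -ltr_pdivrMr//.
  apply: (lt_le_trans (truncnS_gt _)); by rewrite ler_nat.
have h2 : k.+1%:R ^+ 2 * s k.+1 ^+ 2 <= B4 * k.+1%:R.
  apply: le_trans (linear_growth k); rewrite lerDl; apply: mulr_ge0; rewrite ?sqr_ge0//.
  exact: ltW.
rewrite -(ler_pM2l k0); apply: ltW; rewrite (mulrC _ (e ^+ 2)); apply: le_lt_trans h1.
by rewrite -(ler_pM2l k0) mulrA -expr2 (mulrC _ B4).
Qed.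

Let s_little_o e : 0 < e -> exists K, forall k, (K <= k)%N -> k%:R * s k ^+ 2 <= e.
Proof.
move=> e0; pose eta := e / 3.
have eta0 : 0 < eta by rewrite divr_gt0.
have [d d0 hd] : exists2 d, 0 < d & forall k, s k <= d -> - (eta / (2 * G)) <= f k.+1.
  by apply: f_liminf; rewrite divr_gt0 ?mulr_gt0.
have D0 : 0 < B3 + 1 by rewrite ltr_wpDl.
have T0 : 0 < 4 * tau * C ^+ 3 by rewrite !mulr_gt0 ?exprn_gt0.
have [K1 h1] := s_small d0.
have [K2 h2] : exists K, forall k, (K <= k)%N -> s k <= eta / (2 * (B3 + 1)).
  by apply: s_small; rewrite divr_gt0 ?mulr_gt0.
have [K3 h3] : exists K, forall k, (K <= k)%N -> s k <= eta / (4 * tau * C ^+ 3).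
  by apply: s_small; rewrite divr_gt0.
pose K := maxn K1 (maxn K2 K3).
have hK : forall k, (K <= k)%N -> - G * f k.+1 + B3 * s k <= eta.
  move=> k; rewrite !geq_max => /andP[k1 /andP[k2 _]].
  have f1 : - G * f k.+1 <= eta / 2.
    have := ler_wpM2l (ltW G_gt0) (hd _ (h1 _ k1)).
    by rewrite mulrN (_ : G * (eta / (2 * G)) = eta / 2); [lra | field; rewrite gt_eqF].
  have f2 : B3 * s k <= eta / 2.
    apply: (@le_trans _ _ ((B3 + 1) * s k)); first by rewrite ler_wpM2r// lerDl.
    apply: le_trans (ler_wpM2l (ltW D0) (h2 _ k2)) _.
    by rewrite (_ : (B3 + 1) * (eta / (2 * (B3 + 1))) = eta / 2)//; field; rewrite gt_eqF.
  by lra.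
exists (maxn K (Num.trunc (`|P K| / eta))).+1 => -[//|k].
rewrite ltnS geq_max => /andP[kK kT].
have k0 : 0 < k.+1%:R :> R by rewrite ltr0n.
rewrite -(ler_pM2l k0) mulrA -expr2.
have g1 : k.+1%:R ^+ 2 * s k.+1 ^+ 2 <= P k + 4 * tau * C ^+ 3 * s k * k.+1%:R.
  apply: le_trans (potential_ge k); rewrite lerDl; apply: mulr_ge0; rewrite ?sqr_ge0//.
  exact: ltW.
have g2 : 4 * tau * C ^+ 3 * s k * k.+1%:R <= eta * k.+1%:R.
  rewrite ler_wpM2r// mulrC -ler_pdivlMr// h3// (leq_trans _ kK)//.
  by rewrite /K !leq_max leqnn !orbT.
have g3 : P k <= P K + eta * k.+1%:R.
  have := potential_affine hK (k - K); rewrite subnKC// => g; apply: le_trans g _.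
  by rewrite lerD2l ler_pM2l// ler_nat (leq_trans (leq_subr _ _)).
have g4 : P K <= eta * k.+1%:R.
  apply: le_trans (ler_norm _) _; rewrite mulrC -ler_pdivrMr//.
  by apply: le_trans (ltW (truncnS_gt _)) _; rewrite ler_nat ltnS.
by move: g1 g2 g3 g4; rewrite /eta; lra.
Qed.

Lemma energy_cvg0 e : 0 < e -> exists K, forall k, (K <= k)%N -> xt k < e.
Proof.
move=> e0; pose w := alpha * e ^+ 2 / 4.
have w0 : 0 < w by rewrite divr_gt0// mulr_gt0// exprn_gt0.
pose M := B4 / C1 + 1.
have M0 : 0 < M by apply: ltr_wpDl => //; apply: divr_ge0 => //; apply: ltW.
have Lam_le2 k : Lam k ^+ 2 <= M * k.+1%:R.
  have k0 : 0 <= k.+1%:R :> R by rewrite ler0n.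
  apply: (@le_trans _ _ (B4 / C1 * k.+1%:R)); last by rewrite ler_wpM2r// lerDl.
  rewrite mulrAC ler_pdivlMr// mulrC; apply: le_trans (linear_growth k).
  by rewrite lerDr mulr_ge0 ?sqr_ge0.
have C20 : 0 < C ^+ 2 by rewrite exprn_gt0.
have [d d0 hd] := f_liminf w0.
have [K1 h1] := s_small d0.
have [K2 h2] : exists K, forall k, (K <= k)%N -> s k <= w / (3 * C ^+ 2).
  by apply: s_small; rewrite divr_gt0// mulr_gt0.
have [K3 h3] : exists K, forall k, (K <= k)%N ->
    k%:R * s k ^+ 2 <= (w / C ^+ 2) ^+ 2 / (3 * M).
  by apply: s_little_o; rewrite divr_gt0 ?exprn_gt0 ?divr_gt0 ?mulr_gt0.
exists (maxn K1 (maxn K2 K3)).+1 => -[//|k].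
rewrite ltnS !geq_max => /andP[k1 /andP[k2 k3]].
have {}k1 := leqW k1; have {}k2 := leqW k2; have {}k3 := leqW k3.
have {h1}f1 := hd _ (h1 _ k1); have {}h2 := h2 _ k2; have {}h3 := h3 _ k3.
have LS : Lam k.+2 * s k.+1 <= w / C ^+ 2.
  have [wW CW] := (ltW w0, ltW C20).
  have n1 : Lam k.+2 * s k.+1 \is Num.nneg by rewrite nnegrE mulr_ge0.
  have n2 : w / C ^+ 2 \is Num.nneg by rewrite nnegrE; apply: divr_ge0.
  rewrite -(ler_pXn2r (isT : (0 < 2)%N) n1 n2) exprMn.
  have g1 := ler_wpM2r (sqr_ge0 (s k.+1)) (Lam_le2 k.+2).
  apply: le_trans g1 _.
  have g2 : M * k.+3%:R * s k.+1 ^+ 2 <= 3 * M * (k.+1%:R * s k.+1 ^+ 2).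
    have -> : 3 * M * (k.+1%:R * s k.+1 ^+ 2) = M * (3 * k.+1%:R) * s k.+1 ^+ 2 by ring.
    rewrite ler_wpM2r ?sqr_ge0// ler_pM2l// -!natr1.
    have : 0 <= k%:R :> R by rewrite ler0n.
    lra.
  apply: le_trans g2 _; rewrite mulrC -ler_pdivlMr// mulr_gt0//.
have g : alpha * xt k.+1 ^+ 2 < alpha * e ^+ 2.
  apply: le_lt_trans (xt_le _) _.
  have a1 := la_ge k.+1.
  have a2 : C * (Lam k.+2 * vn k.+1) <= w.
    have b1 := ler_wpM2l (Lam0 k.+2) (vn_le k.+1).
    have b2 := ler_wpM2l (ltW C0) b1.
    have b3 := ler_wpM2l (ltW C20) LS.
    rewrite (mulrC _ (w / _)) mulfVK ?gt_eqF// in b3.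
    by lra.
  have a3 : C ^+ 2 * s k.+1 <= w / 3.
    have := ler_wpM2l (ltW C20) h2.
    by rewrite (_ : C ^+ 2 * (w / (3 * C ^+ 2)) = w / 3)//; field; rewrite gt_eqF.
  have a4 := ler_wpM2l (ltW C0) (un_le k.+1).
  have a5 := ler_wpM2l (ltW C0) (vn_le k.+1).
  have w4 : alpha * e ^+ 2 = 4 * w by rewrite /w; field.
  rewrite w4; lra.
by move: g; rewrite ltr_pM2l// ltr_pXn2r ?nnegrE// ltW.
Qed.

End EnergyInequalities.

(** * Inner products and projections *)

Definition inner_product (R : realType) (U : lmodType R) (d : U -> U -> R) :=
  [/\ forall x y, d x y = d y x,
      forall a x y z, d (a *: x + y) z = a * d x z + d y z
    & forall x, 0 <= d x x].

Definition ipnorm (R : realType) (U : lmodType R) (d : U -> U -> R) (x : U) :=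
  Num.sqrt (d x x).

Section InnerProduct.
Variables (R : realType) (U : lmodType R) (d : U -> U -> R).
Hypothesis dP : inner_product d.
Local Notation nrm := (ipnorm d).

Lemma ipC x y : d x y = d y x. Proof. by case: dP. Qed.
Lemma ip_ge0 x : 0 <= d x x. Proof. by case: dP. Qed.
Lemma ipDl x y z : d (x + y) z = d x z + d y z.
Proof. by case: dP => _ h _; have := h 1 x y z; rewrite scale1r mul1r. Qed.
Lemma ip0l z : d 0 z = 0.
Proof. by have := ipDl 0 0 z; rewrite addr0; lra. Qed.
Lemma ipZl a x z : d (a *: x) z = a * d x z.
Proof. by case: dP => _ h _; have := h a x 0 z; rewrite addr0 ip0l addr0. Qed.
Lemma ipNl x z : d (- x) z = - d x z.
Proof. by rewrite -scaleN1r ipZl mulN1r. Qed.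
Lemma ipBl x y z : d (x - y) z = d x z - d y z.
Proof. by rewrite ipDl ipNl. Qed.
Lemma ipDr x y z : d z (x + y) = d z x + d z y.
Proof. by rewrite ipC ipDl !(ipC z). Qed.
Lemma ipZr a x z : d z (a *: x) = a * d z x.
Proof. by rewrite ipC ipZl ipC. Qed.
Lemma ipNr x z : d z (- x) = - d z x.
Proof. by rewrite ipC ipNl ipC. Qed.
Lemma ipBr x y z : d z (x - y) = d z x - d z y.
Proof. by rewrite ipDr ipNr. Qed.
Lemma ip0r z : d z 0 = 0. Proof. by rewrite ipC ip0l. Qed.

Lemma ip_sqrD x y : d (x + y) (x + y) = d x x + 2 * d x y + d y y.
Proof. by rewrite ipDl !ipDr (ipC y x); ring. Qed.

Lemma ipnorm_ge0 x : 0 <= nrm x. Proof. exact: sqrtr_ge0. Qed.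
Lemma sqr_ipnorm x : nrm x ^+ 2 = d x x.
Proof. by rewrite sqr_sqrtr// ip_ge0. Qed.

Lemma ipnormN x : nrm (- x) = nrm x.
Proof. by rewrite /ipnorm ipNl ipNr opprK. Qed.

Lemma ipnormB x y : nrm (x - y) = nrm (y - x).
Proof. by rewrite -ipnormN opprB. Qed.

Lemma ipnormZ a x : nrm (a *: x) = `|a| * nrm x.
Proof. by rewrite /ipnorm ipZl ipZr mulrA -expr2 sqrtrM ?sqr_ge0// sqrtr_sqr. Qed.

Lemma ip_cauchy x y : d x y <= nrm x * nrm y.
Proof.
have x0 := ipnorm_ge0 x; have y0 := ipnorm_ge0 y.
have sx := sqr_ipnorm x; have sy := sqr_ipnorm y.
have h t : 0 <= d x x - 2 * t * d x y + t ^+ 2 * d y y.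
  have := ip_ge0 (x - t *: y).
  by rewrite ipBl !ipBr ipZl !ipZr ipZl (ipC y x); lra.
have [xy|xy] := leP (d x y) 0; first exact: le_trans xy (mulr_ge0 _ _).
have [yy|yy] := eqVneq (d y y) 0.
  have := h ((d x x + 1) / d x y); rewrite yy mulr0 addr0.
  rewrite -mulrA mulfVK ?gt_eqF// => hh.
  by have := ip_ge0 x; lra.
have y1 : 0 < d y y by rewrite lt_neqAle eq_sym yy ip_ge0.
have hh := h (d x y / d y y).
rewrite -(@ler_pXn2r _ 2) ?nnegrE ?mulr_ge0// ?(ltW xy)// exprMn sx sy.
have := mulr_ge0 hh (ltW y1).
set g := (X in 0 <= X) => g0; have gE : g = d x x * d y y - d x y ^+ 2.
  by rewrite /g; field.
by lra.
Qed.

Lemma ip_cauchyN x y : - d x y <= nrm x * nrm y.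
Proof. by rewrite -ipNl -(ipnormN x) ip_cauchy. Qed.

Lemma ler_ipnormD x y : nrm (x + y) <= nrm x + nrm y.
Proof.
rewrite -(@ler_pXn2r _ 2) ?nnegrE ?addr_ge0 ?ipnorm_ge0//.
rewrite sqr_ipnorm sqrrD !sqr_ipnorm ipDl !ipDr (ipC y x).
by have := ip_cauchy x y; lra.
Qed.

Lemma ler_ipnormB x y : nrm (x - y) <= nrm x + nrm y.
Proof. by rewrite -(ipnormN y); exact: ler_ipnormD. Qed.

Lemma ler_ipnorm_sum (I : Type) (r : seq I) (F : I -> U) :
  nrm (\sum_(i <- r) F i) <= \sum_(i <- r) nrm (F i).
Proof.
elim: r => [|i r IH]; first by rewrite !big_nil /ipnorm ip0l sqrtr0.
by rewrite !big_cons (le_trans (ler_ipnormD _ _))// lerD2l.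
Qed.

Lemma proj_variational (S : set U) z p :
  (forall x y t, S x -> S y -> 0 < t < 1 -> S (x + t *: (y - x))) ->
  S p -> (forall y, S y -> nrm (p - z) <= nrm (y - z)) ->
  forall y, S y -> 0 <= d (p - z) (y - p).
Proof.
move=> cS Sp hp y Sy; rewrite leNgt; apply/negP => D0.
set D := d (p - z) (y - p) in D0.
pose E := d (y - p) (y - p); have E0 : 0 <= E := ip_ge0 _.
have ED : 0 < E - D by lra.
pose t := - D / (E - D).
have t0 : 0 < t by rewrite divr_gt0// oppr_gt0.
have t1 : t <= 1 by rewrite ler_pdivrMr// mul1r; lra.
have h (r : R) : 0 < r < 1 -> 0 <= 2 * D + r * E.
  move=> /andP[r0 r1].
  have := hp _ (cS _ _ r Sp Sy (introT andP (conj r0 r1))).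
  rewrite -(@ler_pXn2r _ 2) ?nnegrE ?ipnorm_ge0// !sqr_ipnorm.
  rewrite (_ : p + r *: (y - p) - z = (p - z) + r *: (y - p)); last by rewrite addrAC.
  rewrite (ip_sqrD (p - z)) ipZl !ipZr -/D -/E.
  move=> hh; have : 0 <= r * (2 * D + r * E) by lra.
  by rewrite pmulr_rge0.
have t21 : 0 < t / 2 < 1 by rewrite divr_gt0//=; lra.
have := h _ t21.
have tE : t * (E - D) = - D by rewrite mulfVK ?gt_eqF.
have : 0 <= t * - D by apply: mulr_ge0; lra.
by lra.
Qed.

Lemma proj_nonexpansive (S : set U) z1 z2 p1 p2 :
  (forall x y t, S x -> S y -> 0 < t < 1 -> S (x + t *: (y - x))) ->
  S p1 -> (forall y, S y -> nrm (p1 - z1) <= nrm (y - z1)) ->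
  S p2 -> (forall y, S y -> nrm (p2 - z2) <= nrm (y - z2)) ->
  nrm (p1 - p2) <= nrm (z1 - z2).
Proof.
move=> cS S1 h1 S2 h2.
have e1 := proj_variational cS S1 h1 S2.
have e2 := proj_variational cS S2 h2 S1.
have e3 := ip_cauchy (z1 - z2) (p1 - p2).
have [->|n0] := eqVneq (nrm (p1 - p2)) 0; first exact: ipnorm_ge0.
have n1 : 0 < nrm (p1 - p2) by rewrite lt_neqAle eq_sym n0 ipnorm_ge0.
rewrite -(ler_pM2r n1) -expr2 sqr_ipnorm; apply: le_trans e3.
move: e1 e2; rewrite !(ipBl, ipBr) (ipC p2 p1); lra.
Qed.

End InnerProduct.

(** * The preconditioned primal-dual iteration *)

Section PrimalDual.
Variables (R : realType) (U W : lmodType R) (du : U -> U -> R) (dw : W -> W -> R).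
Hypotheses (duP : inner_product du) (dwP : inner_product dw).
Local Notation nu := (ipnorm du).
Local Notation nw := (ipnorm dw).
Variables (X : set U) (Wp : set W) (A : U -> W) (b : W) (F : U -> U).
Variables (a alpha L tau D : R) (xb : U) (x : nat -> U) (l : nat -> W).
Hypothesis AB : forall y z, A (y - z) = A y - A z.
Hypothesis A_le : forall y, nw (A y) <= a * nu y.
Hypotheses (a0 : 0 <= a) (alpha0 : 0 < alpha) (L0 : 0 < L) (tau0 : 0 < tau).
Hypothesis step_size : tau * (alpha * a ^+ 2 * tau + L ^+ 2) < alpha.
Hypothesis smon : forall y z, X y -> X z ->
  alpha * nu (y - z) ^+ 2 <= du (F y - F z) (y - z).
Hypothesis Flip : forall y z, X y -> X z -> nu (F y - F z) <= L * nu (y - z).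
Hypothesis X_bounded : forall y, X y -> nu (y - xb) <= D.
Hypothesis Wp0 : Wp 0.
Hypothesis WpD : forall y z, Wp y -> Wp z -> Wp (y + z).
Hypothesis Xxb : X xb.
Hypothesis xb_feasible : forall z, Wp z -> 0 <= dw z (b - A xb).
Hypothesis xb_almost_optimal : forall e, 0 < e -> exists2 d, 0 < d &
  forall y r, X y -> nw r <= d -> (forall z, Wp z -> 0 <= dw z (r - (A y - b))) ->
  - e <= du (F xb) (y - xb).
Hypothesis Xx : forall k, X (x k).
Hypothesis Wpl : forall k, Wp (l k).
Let u k := x k.+1 - x k.
Let v k := l k.+1 - l k.
Hypothesis x_step : forall k y, X y ->
  0 <= du (u k) (y - x k.+1) +
       tau * (du (F (x k)) (y - x k.+1) + dw (l k) (A (y - x k.+1))).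
Hypothesis l_step : forall k y, Wp y ->
  0 <= dw (v k) (y - l k.+1) - tau * dw (A (x k.+1) - b + A (u k)) (y - l k.+1).

Let c := tau^-1 - tau * a ^+ 2.

Let c_gt : L ^+ 2 / alpha < c.
Proof.
rewrite ltr_pdivrMr// -(ltr_pM2l tau0).
have -> : tau * (c * alpha) = alpha - tau ^+ 2 * a ^+ 2 * alpha.
  by rewrite /c; field; rewrite gt_eqF.
by move: step_size; lra.
Qed.

Let c_gt0 : 0 < c.
Proof. by apply: le_lt_trans c_gt; rewrite divr_ge0 ?sqr_ge0// ltW. Qed.

Let V (p : U) (r : W) := (du p p + dw r r) / tau - 2 * dw (A p) r.

Let dwA p r : dw (A p) r <= a * nu p * nw r.
Proof.
apply: le_trans (ip_cauchy dwP _ _) _; rewrite ler_wpM2r ?ipnorm_ge0//.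
Qed.

Let V_ge_l p r : c * nu p ^+ 2 <= V p r.
Proof.
rewrite /V -(sqr_ipnorm duP) -(sqr_ipnorm dwP).
have h := dwA p r.
have : 0 <= (nw r - tau * a * nu p) ^+ 2 / tau by rewrite divr_ge0 ?sqr_ge0 ?ltW.
have -> : (nw r - tau * a * nu p) ^+ 2 / tau =
  nw r ^+ 2 / tau - 2 * (a * nu p * nw r) + tau * a ^+ 2 * nu p ^+ 2.
  by field; rewrite gt_eqF.
by rewrite /c; lra.
Qed.

Let V_ge_r p r : c * nw r ^+ 2 <= V p r.
Proof.
rewrite /V -(sqr_ipnorm duP) -(sqr_ipnorm dwP).
have h := dwA p r.
have : 0 <= (nu p - tau * a * nw r) ^+ 2 / tau by rewrite divr_ge0 ?sqr_ge0 ?ltW.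
have -> : (nu p - tau * a * nw r) ^+ 2 / tau =
  nu p ^+ 2 / tau - 2 * (a * nu p * nw r) + tau * a ^+ 2 * nw r ^+ 2.
  by field; rewrite gt_eqF.
by rewrite /c; lra.
Qed.

Let V_ge0 p r : 0 <= V p r.
Proof. by apply: le_trans (V_ge_l p r); rewrite mulr_ge0 ?sqr_ge0 ?ltW. Qed.

Let V_le p r : V p r <= (tau^-1 + a) * (nu p ^+ 2 + nw r ^+ 2).
Proof.
rewrite /V -(sqr_ipnorm duP) -(sqr_ipnorm dwP).
have h : - dw (A p) r <= a * nu p * nw r.
  apply: le_trans (ip_cauchyN dwP _ _) _; rewrite ler_wpM2r ?ipnorm_ge0//.
have := mulr_ge0 a0 (sqr_ge0 (nu p - nw r)).
by lra.
Qed.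

Let A0 : A 0 = 0. Proof. by rewrite -(subrr 0) AB subrr. Qed.
Let AN y : A (- y) = - A y. Proof. by rewrite -sub0r AB A0 sub0r. Qed.

Let x_mono k : du (u k.+1 - u k) (u k.+1) +
  tau * (du (F (x k.+1) - F (x k)) (u k.+1) + dw (v k) (A (u k.+1))) <= 0.
Proof.
have := x_step k (Xx k.+2); have := x_step k.+1 (Xx k.+1).
rewrite -[x k.+1 - x k.+2]opprB -/(u k.+1) AN.
rewrite /v !(ipBl duP, ipBl dwP, ipNr duP, ipNr dwP); lra.
Qed.

Let l_mono k : dw (v k.+1 - v k) (v k.+1) -
  tau * dw (A (u k.+1) + A (u k.+1) - A (u k)) (v k.+1) <= 0.
Proof.
have := l_step k (Wpl k.+2); have := l_step k.+1 (Wpl k.+1).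
rewrite -[l k.+1 - l k.+2]opprB -/(v k.+1).
have -> : A (u k.+1) = A (x k.+2) - A (x k.+1) by rewrite AB.
move: (v k.+1) (v k) => v1 v0.
rewrite !(ipDl dwP, ipNl dwP, ipNr dwP); lra.
Qed.

Let V_decr k : V (u k.+1) (v k.+1) <= V (u k) (v k) - alpha * nu (u k) ^+ 2.
Proof.
set dF := F (x k.+1) - F (x k).
have h1 := x_mono k; have h2 := l_mono k.
have h3 := V_ge_l (u k.+1 - u k) (v k.+1 - v k).
have h4 : alpha * nu (u k) ^+ 2 <= du dF (u k) by exact: smon.
have h5 : - du dF (u k.+1 - u k) <= L * nu (u k) * nu (u k.+1 - u k).
  apply: le_trans (ip_cauchyN duP _ _) _.
  by rewrite ler_wpM2r ?ipnorm_ge0//; exact: Flip.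
have h6 : 2 * (L * nu (u k) * nu (u k.+1 - u k)) <=
    alpha * nu (u k) ^+ 2 + c * nu (u k.+1 - u k) ^+ 2.
  set p := nu (u k); set r := nu (u k.+1 - u k).
  have e1 : 0 <= (alpha * p - L * r) ^+ 2 / alpha by rewrite divr_ge0 ?sqr_ge0 ?ltW.
  have e2 : (alpha * p - L * r) ^+ 2 / alpha = alpha * p ^+ 2 - 2 * (L * p * r)
     + L ^+ 2 / alpha * r ^+ 2 by field; rewrite gt_eqF.
  have e3 := ler_wpM2r (sqr_ge0 r) (ltW c_gt).
  by lra.
have h7 : (du (u k.+1 - u k) (u k.+1) + dw (v k.+1 - v k) (v k.+1)) / tau +
    du dF (u k.+1) + dw (v k) (A (u k.+1)) -
    dw (A (u k.+1) + A (u k.+1) - A (u k)) (v k.+1) <= 0.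
  rewrite -(ler_pM2l tau0) mulr0.
  set g := (X in X <= 0); suff -> : g = du (u k.+1 - u k) (u k.+1) +
    tau * (du dF (u k.+1) + dw (v k) (A (u k.+1))) + (dw (v k.+1 - v k) (v k.+1) -
    tau * dw (A (u k.+1) + A (u k.+1) - A (u k)) (v k.+1)) by move: h1 h2; lra.
  by rewrite /g; field; rewrite gt_eqF.
clear h1 h2; move: h3 h4 h5 h6 h7; rewrite /V AB.
move: dF (u k.+1) (u k) (v k.+1) (v k) => dF u1 u0 v1 v0.
rewrite !(ipBr duP, ipBl duP, ipDl dwP, ipDr dwP, ipNl dwP, ipNr dwP).
rewrite (ipC duP u1 u0) (ipC dwP v1 v0) (ipC dwP v0 (A u1)).
lra.
Qed.


Let la k := dw (l k) (A (x k) - b).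
Let f k := du (F xb) (x k - xb).
Let xt k := nu (x k - xb).

Let Au k : A (u k) = A (x k.+1) - A (x k). Proof. by rewrite AB. Qed.

Let dwAN p r : - dw (A p) r <= a * nu p * nw r.
Proof. by apply: le_trans (ip_cauchyN dwP _ _) _; rewrite ler_wpM2r ?ipnorm_ge0. Qed.

Let l_cone k z : Wp z -> tau * dw (A (x k.+1) - b + A (u k)) z <= dw (v k) z.
Proof.
by move=> Wz; have := l_step k (WpD (Wpl k.+1) Wz); rewrite (addrC (l k.+1)) addrK; lra.
Qed.

Let l_complementary k :
  dw (v k) (l k.+1) = tau * dw (A (x k.+1) - b + A (u k)) (l k.+1).
Proof.
apply/eqP; rewrite eq_le; apply/andP; split; last exact: l_cone.
by have := l_step k Wp0; rewrite sub0r !(ipNr dwP); lra.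
Qed.

Let vn_sqr_le k : nw (v k) ^+ 2 <= tau * dw (A (x k.+1) - b + A (u k)) (v k).
Proof.
have := l_step k (Wpl k); rewrite -[l k - _]opprB -/(v k) !(ipNr dwP) (sqr_ipnorm dwP); lra.
Qed.

Let vn_telescope k : nw (v k.+1) ^+ 2 <=
  tau * (la k.+2 + f k.+2 - (la k.+1 + f k.+1)) +
  nu (u k.+1) * (tau * L * xt k + nu (u k) + tau * a * (nw (v k) + nw (v k.+1))).
Proof.
have h1 := vn_sqr_le k.+1.
have h2 := x_step k (Xx k.+2).
have h3 := ip_cauchy duP (u k) (u k.+1).
have h4 : tau * du (F (x k) - F xb) (u k.+1) <= tau * (L * xt k * nu (u k.+1)).
  rewrite ler_pM2l//; apply: le_trans (ip_cauchy duP _ _) _.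
  by rewrite ler_wpM2r ?ipnorm_ge0//; exact: Flip.
have h5 := ler_wpM2l (ltW tau0) (dwAN (u k.+1) (v k)).
have h6 := ler_wpM2l (ltW tau0) (dwA (u k.+1) (v k.+1)).
have h7 : dw (A (x k.+2) - b) (v k.+1) =
    la k.+2 - la k.+1 - dw (l k) (A (u k.+1)) - dw (A (u k.+1)) (v k).
  rewrite /la Au /v !(ipDl dwP, ipDr dwP, ipNl dwP, ipNr dwP).
  rewrite !(ipC dwP (A _)) !(ipC dwP b); ring.
have h8 : du (F (x k)) (u k.+1) = du (F (x k) - F xb) (u k.+1) + (f k.+2 - f k.+1).
  by rewrite /f /u !(ipBl duP, ipBr duP); ring.
move: h1 h2; rewrite (ipDl dwP) h7 -/(u k.+1) h8; lra.
Qed.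

Let Da := a * D + nw (A xb - b).
Let D_ge0 : 0 <= D. Proof. exact: le_trans (ipnorm_ge0 _ _) (X_bounded Xxb). Qed.

Let a_bounded k : nw (A (x k) - b) <= Da.
Proof.
have -> : A (x k) - b = A (x k - xb) + (A xb - b).
  by rewrite AB addrA subrK.
apply: le_trans (ler_ipnormD dwP _ _) _; rewrite lerD2r.
by apply: le_trans (A_le _) _; rewrite ler_wpM2l// X_bounded.
Qed.

Let xt_le k : alpha * xt k ^+ 2 <= - (la k.+1 + f k.+1) +
  (Da * nw (v k) + (L * D + D / tau) * nu (u k)).
Proof.
have h1 : 0 <= du (u k) (xb - x k.+1) / tau +
    (du (F (x k)) (xb - x k.+1) + dw (l k) (A (xb - x k.+1))).
  have := x_step k Xxb; rewrite -(pmulr_rge0 _ (_ : 0 < tau^-1)) ?invr_gt0//.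
  by rewrite mulrDr mulrA mulVf ?gt_eqF// mul1r mulrC.
have h2 := xb_feasible (Wpl k).
have h3 : alpha * xt k ^+ 2 <= du (F (x k) - F xb) (x k - xb) by exact: smon.
have h4 : - du (F (x k) - F xb) (u k) <= L * D * nu (u k).
  apply: le_trans (ip_cauchyN duP _ _) _; rewrite ler_wpM2r ?ipnorm_ge0//.
  by apply: le_trans (Flip _ _) _ => //; rewrite ler_pM2l// X_bounded.
have h5 : du (u k) (xb - x k.+1) / tau <= D / tau * nu (u k).
  rewrite mulrAC ler_pM2r ?invr_gt0//.
  apply: le_trans (ip_cauchy duP _ _) _; rewrite mulrC ler_wpM2r ?ipnorm_ge0//.
  by rewrite (ipnormB duP) X_bounded.
have h6 : dw (v k) (A (x k.+1) - b) <= Da * nw (v k).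
  by apply: le_trans (ip_cauchy dwP _ _) _; rewrite mulrC ler_wpM2r ?ipnorm_ge0.
have h7 : la k.+1 = dw (v k) (A (x k.+1) - b) - dw (l k) (A (xb - x k.+1))
    - dw (l k) (b - A xb).
  rewrite /la /v AB !(ipDl dwP, ipDr dwP, ipNl dwP, ipNr dwP); ring.
have h8 : du (F (x k)) (xb - x k.+1) = - f k.+1 - du (F (x k) - F xb) (x k - xb)
   - du (F (x k) - F xb) (u k).
  by rewrite /f /u !(ipBl duP, ipBr duP); ring.
rewrite h7; move: h1; rewrite h8; lra.
Qed.

Let Fm := nu (F xb) + L * D.
Let F_bounded k : nu (F (x k)) <= Fm.
Proof.
have -> : F (x k) = F xb + (F (x k) - F xb) by rewrite addrC subrK.
apply: le_trans (ler_ipnormD duP _ _) _; rewrite lerD2l.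
by apply: le_trans (Flip _ _) _ => //; rewrite ler_pM2l// X_bounded.
Qed.

Let s k := Num.sqrt (V (u k) (v k)).
Let cs := (Num.sqrt c)^-1.

Let sqr_s k : s k ^+ 2 = V (u k) (v k).
Proof. by rewrite sqr_sqrtr ?V_ge0. Qed.

Let cs_mul z y : 0 <= z -> c * z ^+ 2 <= V (u y) (v y) -> z <= cs * s y.
Proof.
move=> z0 h; have cW := ltW c_gt0.
rewrite /cs mulrC ler_pdivlMr ?sqrtr_gt0//.
rewrite -(@ler_pXn2r _ 2) ?nnegrE ?mulr_ge0 ?sqrtr_ge0//.
by rewrite exprMn sqr_s sqr_sqrtr// mulrC.
Qed.

Let un_le k : nu (u k) <= cs * s k.
Proof. by apply: cs_mul; rewrite ?ipnorm_ge0// V_ge_l. Qed.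

Let vn_le k : nw (v k) <= cs * s k.
Proof. by apply: cs_mul; rewrite ?ipnorm_ge0// V_ge_r. Qed.

Let cs_ge0 : 0 <= cs. Proof. by rewrite invr_ge0 sqrtr_ge0. Qed.

Let s_ge0 k : 0 <= s k. Proof. exact: sqrtr_ge0. Qed.

Let s_le0 k : s k <= s 0%N.
Proof.
elim: k => // k IH; apply: le_trans IH.
rewrite -(@ler_pXn2r _ 2) ?nnegrE// !sqr_s; apply: le_trans (V_decr k) _.
by rewrite lerBlDr lerDl mulr_ge0 ?sqr_ge0 ?ltW.
Qed.

Let vm := cs * s 0%N.
Let vn_le0 k : nw (v k) <= vm.
Proof. by apply: le_trans (vn_le k) _; rewrite ler_wpM2l. Qed.

Let l_Au_le k : dw (l k.+1) (A (u k)) <= (a * vm + Fm) * nu (u k).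
Proof.
have h1 := x_step k (Xx k).
have h2 : - du (F (x k)) (u k) <= Fm * nu (u k).
  by apply: le_trans (ip_cauchyN duP _ _) _; rewrite ler_wpM2r ?ipnorm_ge0.
have h3 : dw (A (u k)) (v k) <= a * vm * nu (u k).
  apply: le_trans (dwA _ _) _; rewrite mulrAC ler_wpM2r ?ipnorm_ge0//.
  by rewrite ler_wpM2l.
have h4 : 0 <= - du (F (x k)) (u k) - dw (l k) (A (u k)).
  rewrite -(pmulr_rge0 _ tau0).
  move: h1; rewrite -[x k - _]opprB -/(u k) AN !(ipNr duP) (ipNr dwP).
  by have := ip_ge0 duP (u k); lra.
have -> : dw (l k.+1) (A (u k)) = dw (A (u k)) (v k) + dw (l k) (A (u k)).
  by rewrite /v (ipBr dwP) !(ipC dwP (A _)) subrK.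
by lra.
Qed.

Let Lam_le k : nw (l k.+1) ^+ 2 - nw (l k) ^+ 2 <=
  2 * tau * la k.+1 + 2 * tau * (a * vm + Fm) * nu (u k).
Proof.
have h1 := ler_wpM2l (ltW tau0) (l_Au_le k).
have h2 := l_complementary k.
have h3 : nw (l k.+1) ^+ 2 - nw (l k) ^+ 2 = 2 * dw (v k) (l k.+1) - dw (v k) (v k).
  rewrite !(sqr_ipnorm dwP) /v !(ipDl dwP, ipDr dwP, ipNl dwP, ipNr dwP).
  by rewrite (ipC dwP (l k.+1) (l k)); ring.
have := ip_ge0 dwP (v k); rewrite h3 h2 (ipDl dwP) /la.
by rewrite !(ipC dwP _ (l k.+1)); lra.
Qed.

Let la_ge k : - la k.+1 <= tau^-1 * (nw (l k.+1) * nw (v k)) + (a * vm + Fm) * nu (u k).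
Proof.
have h1 := l_Au_le k; have h2 := l_complementary k.
have h3 : - dw (v k) (l k.+1) / tau <= tau^-1 * (nw (l k.+1) * nw (v k)).
  by rewrite mulrC ler_pM2l ?invr_gt0// mulrC ip_cauchyN.
have h4 : dw (v k) (l k.+1) / tau = la k.+1 + dw (l k.+1) (A (u k)).
  by rewrite h2 (ipDl dwP) !(ipC dwP _ (l k.+1)) -/(la k.+1) mulrC mulrA mulVf ?gt_eqF// mul1r.
by move: h3; rewrite mulNr h4; lra.
Qed.

Let f_liminf e : 0 < e -> exists2 d, 0 < d & forall k, s k <= d -> - e <= f k.+1.
Proof.
move=> /xb_almost_optimal [d d0 hd].
pose m := cs * (tau^-1 + a) + 1.
have m0 : 0 < m by rewrite ltr_wpDl// mulr_ge0 ?addr_ge0 ?invr_ge0// ltW.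
exists (d / m); first by rewrite divr_gt0.
move=> k; rewrite ler_pdivlMr// => sk.
apply: (hd _ (tau^-1 *: v k - A (u k))) => //.
  apply: le_trans sk; apply: le_trans (ler_ipnormB dwP _ _) _.
  rewrite (ipnormZ dwP) gtr0_norm ?invr_gt0//.
  have tV : 0 <= tau^-1 by rewrite invr_ge0 ltW.
  have h1 := ler_wpM2l tV (vn_le k).
  have h2 := ler_wpM2l a0 (un_le k).
  have h3 := A_le (u k); have h4 := s_ge0 k.
  by rewrite /m; lra.
move=> z Wz; have := l_cone k Wz; move: (v k) => v0.
rewrite -(pmulr_rge0 _ tau0) (ipC dwP z) !(ipDl dwP, ipNl dwP, ipZl dwP).
rewrite !mulrDr mulrA mulfV ?gt_eqF// mul1r; lra.
Qed.

Lemma primal_dual_cvg e : 0 < e -> exists K, forall k, (K <= k)%N -> nu (x k - xb) < e.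
Proof.
pose c1 := tau^-1 + a.
pose c2 := tau * L + 1 + tau * a.
pose c3 := Da + (L * D + D / tau).
pose c4 := a * vm + Fm.
pose c5 := nu (F xb) * D.
pose C := cs + c1 + c2 + c3 + (2 * tau * c4) + (tau^-1 + c4) + c5.
have [tW LW] := (ltW tau0, ltW L0).
have tV : 0 <= tau^-1 by rewrite invr_ge0.
have vm0 : 0 <= vm by rewrite mulr_ge0.
have tLp : 0 <= tau * L by rewrite mulr_ge0.
have tap : 0 <= tau * a by rewrite mulr_ge0.
have LDp : 0 <= L * D by rewrite mulr_ge0.
have Dtp : 0 <= D / tau by rewrite mulr_ge0.
have Da0 : 0 <= Da by apply: addr_ge0; rewrite ?mulr_ge0 ?ipnorm_ge0.
have Fm0 : 0 <= Fm by apply: addr_ge0; rewrite ?mulr_ge0 ?ipnorm_ge0.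
have c10 : 0 <= c1 by apply: addr_ge0.
have c20 : 1 <= c2 by rewrite /c2; lra.
have c30 : 0 <= c3 by rewrite /c3; lra.
have c40 : 0 <= c4 by apply: addr_ge0 => //; apply: mulr_ge0.
have c4t : 0 <= 2 * tau * c4 by rewrite mulr_ge0// mulr_ge0.
have c50 : 0 <= c5 by apply: mulr_ge0; rewrite ?ipnorm_ge0.
have cs0 := cs_ge0.
have csC : cs <= C by rewrite /C; lra.
have c1C : c1 <= C by rewrite /C; lra.
have c2C : c2 <= C by rewrite /C; lra.
have c3C : c3 <= C by rewrite /C; lra.
have c4C : 2 * tau * c4 <= C by rewrite /C; lra.
have c4C' : c4 <= C by rewrite /C; lra.
have tC : tau^-1 <= C by rewrite /C; lra.
have c5C : c5 <= C by rewrite /C; lra.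
have C0 : 0 < C by lra.
have un0 k : 0 <= nu (u k) by exact: ipnorm_ge0.
have vn0 k : 0 <= nw (v k) by exact: ipnorm_ge0.
have xt0 k : 0 <= xt k by exact: ipnorm_ge0.
have Lam0 k : 0 <= nw (l k) by exact: ipnorm_ge0.
have C2 : [/\ tau * L <= C, 1 <= C & tau * a <= C] by rewrite /c2 in c2C; split; lra.
have C3 : Da <= C /\ L * D + D / tau <= C by rewrite /c3 in c3C; split; lra.
clearbody C.
apply: (@energy_cvg0 R alpha tau C s (fun k => nu (u k)) (fun k => nw (v k)) xt
  (fun k => nw (l k)) la f) => //.
- by move=> k; rewrite !sqr_s; exact: V_decr.
- by move=> k; apply: le_trans (un_le k) _; rewrite ler_wpM2r.
- by move=> k; apply: le_trans (vn_le k) _; rewrite ler_wpM2r.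
- move=> k; rewrite sqr_s; apply: le_trans (V_le _ _) _.
  by rewrite ler_wpM2r// addr_ge0 ?sqr_ge0.
- move=> k; apply: le_trans (vn_telescope k) _; rewrite lerD2l mulrCA ler_wpM2l//.
  have [C21 C22 C23] := C2.
  have h1 := ler_wpM2r (xt0 k) C21; have h2 := ler_wpM2r (un0 k) C22.
  have h3 := ler_wpM2r (vn0 k) C23; have h4 := ler_wpM2r (vn0 k.+1) C23.
  by lra.
- move=> k; apply: le_trans (xt_le k) _; rewrite lerD2l.
  have [C31 C32] := C3.
  by have := ler_wpM2r (vn0 k) C31; have := ler_wpM2r (un0 k) C32; lra.
- move=> k; apply: le_trans (Lam_le k) _; by rewrite lerD2l ler_wpM2r.
- move=> k; apply: le_trans (la_ge k) _; rewrite mulrDr.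
  by apply: lerD; rewrite ler_wpM2r ?mulr_ge0.
- move=> k; rewrite lerNl; apply: le_trans (ip_cauchyN duP _ _) _.
  by apply: le_trans c5C; rewrite ler_wpM2l ?ipnorm_ge0// X_bounded.
Qed.

End PrimalDual.

(** * Stacked vectors and compactness *)

Section Stacked.
Variable R : realType.

Lemma vdot_inner_product n : inner_product (@vdot R n).
Proof.
split=> [x y|a x y z|x].
- by apply: eq_bigr => k _; rewrite mulrC.
- rewrite /vdot mulr_sumr -big_split/=; apply: eq_bigr => k _.
  by rewrite !mxE; ring.
- by apply: sumr_ge0 => k _; rewrite -expr2 sqr_ge0.
Qed.

Lemma sdot_inner_product N n : inner_product (@sdot R N n).
Proof.
split=> [x y|a x y z|x].
- by apply: eq_bigr => i _; rewrite (ipC (vdot_inner_product n)).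
- rewrite /sdot mulr_sumr -big_split/=; apply: eq_bigr => i _.
  by rewrite (ipDl (vdot_inner_product n)) (ipZl (vdot_inner_product n)).
- by apply: sumr_ge0 => i _; exact: ip_ge0 (vdot_inner_product n) _.
Qed.

Lemma ssubE N n (x y : 'I_N -> 'cV[R]_n) : ssub x y = x - y.
Proof. by []. Qed.

Lemma snormE N n (x : 'I_N -> 'cV[R]_n) : snorm x = ipnorm (@sdot R N n) x.
Proof. by []. Qed.

Lemma sqrt_sumsq_le (I : Type) (r : seq I) (a : I -> R) :
  (forall i, 0 <= a i) ->
  Num.sqrt (\sum_(i <- r) a i ^+ 2) <= \sum_(i <- r) a i.
Proof.
move=> a0; have s0 t : 0 <= \sum_(i <- t) a i by apply: sumr_ge0.
rewrite -[leRHS]ger0_norm ?s0// -sqrtr_sqr ler_wsqrtr//.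
elim: r => [|i r IH]; first by rewrite !big_nil expr0n.
rewrite !big_cons sqrrD; have := mulr_ge0 (a0 i) (s0 r); lra.
Qed.

Lemma vnorm_le_sum n (u : 'cV[R]_n) : vnorm u <= \sum_(k < n) `|u k 0|.
Proof.
rewrite /vnorm /vdot (eq_bigr (fun k => `|u k 0| ^+ 2)); last first.
  by move=> k _; rewrite real_normK ?num_real// expr2.
exact: sqrt_sumsq_le.
Qed.

Lemma snorm_le_sum N n (x : 'I_N -> 'cV[R]_n) : snorm x <= \sum_(i < N) vnorm (x i).
Proof.
rewrite /snorm /sdot (eq_bigr (fun i => vnorm (x i) ^+ 2)); last first.
  by move=> i _; rewrite (sqr_ipnorm (vdot_inner_product n)).
by apply: sqrt_sumsq_le => i; exact: sqrtr_ge0.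
Qed.

Lemma vnorm_le_snorm N n (x : 'I_N -> 'cV[R]_n) i : vnorm (x i) <= snorm x.
Proof.
apply: ler_wsqrtr; rewrite /sdot (bigD1 i)//= lerDl.
by apply: sumr_ge0 => j _; exact: ip_ge0 (vdot_inner_product n) _.
Qed.

Lemma coord_le_vnorm n (u : 'cV[R]_n) k : `|u k 0| <= vnorm u.
Proof.
rewrite -sqrtr_sqr; apply: ler_wsqrtr; rewrite /vdot (bigD1 k)//= -expr2 lerDl.
by apply: sumr_ge0 => j _; rewrite -expr2 sqr_ge0.
Qed.

Lemma snorm_eq0 N n (x : 'I_N -> 'cV[R]_n) : snorm x = 0 -> x = 0.
Proof.
move=> x0; apply/funext => i; apply/colP => k; rewrite [RHS]mxE.
apply/eqP; rewrite -normr_le0 -x0.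
exact: le_trans (coord_le_vnorm _ _) (vnorm_le_snorm _ _).
Qed.

Lemma nbhs_snorm N n (x : prod_topology (fun _ : 'I_N => 'cV[R]_n)) (e : R) : 0 < e ->
  nbhs x [set y | snorm (ssub y x) < e].
Proof.
move=> e0; pose d := e / (N * n).+1%:R.
have d0 : 0 < d by rewrite divr_gt0.
have near_coord : nbhs x [set y : 'I_N -> 'cV[R]_n |
    forall i k, `|(x i : 'cV[R]_n) k 0 - y i k 0| < d].
  apply: (@filter_forall _ _ (fun i (y : 'I_N -> 'cV[R]_n) =>
    forall k, `|(x i : 'cV[R]_n) k 0 - y i k 0| < d) _ (nbhs_filter x)) => i.
  apply: (@filter_forall _ _ (fun k (y : 'I_N -> 'cV[R]_n) =>
    `|(x i : 'cV[R]_n) k 0 - y i k 0| < d) _ (nbhs_filter x)) => k.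
  have cvg_coord : (fun y : prod_topology (fun _ : 'I_N => 'cV[R]_n) =>
      (y i : 'cV[R]_n) k 0) @ x --> (x i : 'cV[R]_n) k 0.
    have ci : proj i @ x --> (x i : 'cV[R]_n).
      exact: (@proj_continuous 'I_N (fun _ => 'cV[R]_n : topologicalType) i x).
    exact: cvg_comp _ _ ci (@coord_continuous R n 1 k 0 (x i)).
  by move/cvgrPdist_lt: cvg_coord; apply.
apply: (@filterS _ _ (nbhs_filter x) _ _ _ near_coord) => y hy /=.
apply: le_lt_trans (snorm_le_sum _) _.
have hv i : vnorm (ssub y x i) <= n%:R * d.
  apply: le_trans (vnorm_le_sum _) _.
  rewrite -[n in n%:R]card_ord mulr_natl -sumr_const; apply: ler_sum => k _.
  by rewrite !mxE distrC ltW.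
apply: (@le_lt_trans _ _ (N%:R * (n%:R * d))).
  by rewrite -[N in N%:R]card_ord mulr_natl -sumr_const; apply: ler_sum.
rewrite mulrA -natrM /d mulrCA gtr_pMr// ltr_pdivrMr// mul1r ltr_nat//.
Qed.

Lemma stacked_min N n (X : 'I_N -> set 'cV[R]_n) (S : set ('I_N -> 'cV[R]_n))
    (f : ('I_N -> 'cV[R]_n) -> R) (C : R) :
  (forall i, compact (X i)) -> (forall x, S x -> in_prod X x) -> S !=set0 ->
  (forall p, in_prod X p ->
    (forall e, 0 < e -> exists2 y, S y & snorm (ssub y p) < e) -> S p) ->
  (forall x y, S x -> S y -> f x - f y <= C * snorm (ssub x y)) ->
  exists2 p, S p & forall y, S y -> f p <= f y.
Proof.
move=> cX SX S0 clS fC.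
pose T := prod_topology (fun _ : 'I_N => 'cV[R]_n).
have cK : compact ([set x | in_prod X x] : set T).
  exact: (@tychonoff _ (fun _ : 'I_N => 'cV[R]_n) X cX).
have hT : hausdorff_space T.
  by apply: hausdorff_product => i; exact: norm_hausdorff.
have cS : compact (S : set T).
  apply: (subclosed_compact _ cK SX) => p clp.
  apply: clS => [|e e0].
    have : closed ([set x | in_prod X x] : set T) by exact: compact_closed.
    by apply; apply: closure_subset clp => x /SX.
  by have [y [Sy yp]] := clp _ (nbhs_snorm p e0); exists y.
have cf : {within (S : set T), continuous (f : T -> R)}.
  rewrite continuous_subspace_in => x; rewrite inE => Sx.
  apply/cvgrPdist_lt => e e0.
  suff : within (S : set T) (nbhs (x : T)) [set y | `|f x - f y| < e].
    by rewrite (nbhs_subspace_in Sx).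
  have C0 : 0 < `|C| + 1 by rewrite ltr_wpDl.
  have eC : 0 < e / (`|C| + 1) by rewrite divr_gt0.
  apply: (@filterS _ _ (nbhs_filter (x : T)) _ _ _ (nbhs_snorm x eC)) => y yx Sy /=.
  rewrite /= in yx.
  have xy : snorm (ssub x y) = snorm (ssub y x).
    by rewrite !snormE !ssubE (ipnormB (sdot_inner_product N n)).
  have hC : C * snorm (ssub y x) < e.
    apply: (@le_lt_trans _ _ ((`|C| + 1) * snorm (ssub y x))).
      by rewrite ler_wpM2r ?sqrtr_ge0//; have := ler_norm C; lra.
    by rewrite mulrC -ltr_pdivlMr.
  have := fC _ _ Sx Sy; have := fC _ _ Sy Sx; rewrite xy => h1 h2.
  by rewrite ltr_norml; apply/andP; split; lra.
have S0' : (S : set T) !=set0 by [].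
have [p Sp hp] := compact_EVT_min S0' cS cf.
by exists p => [|y Sy]; [exact: set_mem Sp | apply: hp; exact: mem_set].
Qed.

End Stacked.

(** * The operator A_nu and the communication steps *)

Section Operators.
Variable R : realType.

Lemma mulmx_bounded m n (M : 'M[R]_(m, n)) :
  exists2 C, 0 <= C & forall v : 'cV[R]_n, vnorm (M *m v) <= C * vnorm v.
Proof.
exists (\sum_(i < m) vnorm (row i M)^T); first by apply: sumr_ge0 => i _; exact: sqrtr_ge0.
move=> v; apply: le_trans (vnorm_le_sum _) _; rewrite mulr_suml; apply: ler_sum => i _.
have -> : (M *m v) i 0 = vdot (row i M)^T v.
  by rewrite mxE; apply: eq_bigr => j _; rewrite !mxE.
rewrite ler_norml lerNl.
by rewrite (ip_cauchy (vdot_inner_product R n)) (ip_cauchyN (vdot_inner_product R n)).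
Qed.

Variables (N n m : nat) (T : 'M[R]_N) (nu : nat) (Ahat : 'M[R]_(m, n)).
Local Notation A := (@A_nu R N n m T nu Ahat).
Local Notation sn := (sdot_inner_product R N n).
Local Notation sm := (sdot_inner_product R N m).

Lemma A_nuZD a x y : A (a *: x + y) = a *: A x + A y.
Proof.
apply/funext => i; transitivity (a *: A x i + A y i) => //.
rewrite /A_nu scaler_sumr -big_split/=; apply: eq_bigr => j _.
transitivity (mxpow T nu i j *: (Ahat *m (a *: x j + y j))) => //.
by rewrite mulmxDr -scalemxAr scalerDr !scalerA mulrC.
Qed.

Lemma A_nuB x y : A (x - y) = A x - A y.
Proof. by rewrite addrC -scaleN1r A_nuZD scaleN1r addrC. Qed.

Lemma A_nuZ a x : A (a *: x) = a *: A x.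
Proof. by have := A_nuZD a x 0; rewrite addr0 -(subrr x) A_nuB !subrr addr0. Qed.

Lemma A_nu_bounded : exists C, forall x, snorm (A x) <= C * snorm x.
Proof.
have [C C0 hC] := mulmx_bounded Ahat.
exists (\sum_(i < N) \sum_(j < N) `|mxpow T nu i j| * C) => x.
apply: le_trans (snorm_le_sum _) _; rewrite mulr_suml; apply: ler_sum => i _.
rewrite mulr_suml; apply: le_trans (ler_ipnorm_sum (vdot_inner_product R m) _ _) _.
apply: ler_sum => j _; rewrite (ipnormZ (vdot_inner_product R m)) -mulrA.
rewrite ler_wpM2l//; apply: le_trans (hC _) _.
by rewrite ler_wpM2l// vnorm_le_snorm.
Qed.

Lemma A_nu_norm_has_ubound : has_ubound [set r | exists x : 'I_N -> 'cV[R]_n,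
  snorm x <= 1 /\ r = snorm (A x)].
Proof.
have [C hC] := A_nu_bounded.
exists `|C| => _ [y [y1 ->]]; apply: le_trans (hC y) _.
apply: le_trans (ler_wpM2r (sqrtr_ge0 _) (ler_norm C)) _.
by rewrite ler_piMr.
Qed.

Lemma A_nu_norm_ge0 : 0 <= A_nu_norm T nu Ahat.
Proof.
apply: (le_trans (sqrtr_ge0 (sdot (A 0) (A 0)))).
apply: (ub_le_sup A_nu_norm_has_ubound); exists 0; split=> //.
by rewrite snormE /ipnorm (ip0l sn) sqrtr0.
Qed.

Lemma A_nu_norm_le x : snorm (A x) <= A_nu_norm T nu Ahat * snorm x.
Proof.
have [C hC] := A_nu_bounded.
have [x0|x0] := eqVneq (snorm x) 0.
  by have := hC x; rewrite x0 !mulr0.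
have x1 : 0 < snorm x by rewrite lt_neqAle eq_sym x0 sqrtr_ge0.
rewrite -ler_pdivrMr//.
have -> : snorm (A x) / snorm x = snorm (A ((snorm x)^-1 *: x)).
  by rewrite A_nuZ !snormE (ipnormZ sm) gtr0_norm ?invr_gt0// mulrC.
apply: (ub_le_sup A_nu_norm_has_ubound); exists ((snorm x)^-1 *: x); split=> //.
by rewrite [leLHS](ipnormZ sn) gtr0_norm ?invr_gt0// mulVf.
Qed.

Lemma sigma_nu_iter x : iter nu (mix_in T) x = sigma_nu T nu x :> ('I_N -> 'cV[R]_n).
Proof.
elim: nu x => [|k IH] x; apply/funext => i.
  rewrite /sigma_nu /= (bigD1 i)//= big1 => [|j ji]; rewrite mxE.
    by rewrite eqxx scale1r addr0.
  by rewrite eq_sym (negbTE ji) scale0r.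
rewrite iterSr IH /sigma_nu /mix_in.
transitivity (\sum_(j < N) \sum_(h < N) (mxpow T k i j * T j h) *: x h).
  apply: eq_bigr => j _; rewrite scaler_sumr; apply: eq_bigr => h _.
  by rewrite scalerA.
rewrite exchange_big /=; apply: eq_bigr => h _; rewrite -scaler_suml.
by congr (_ *: _); rewrite mxE.
Qed.

Lemma mix_out_iter p (l : 'I_N -> 'cV[R]_p) i :
  iter nu (mix_out T) l i = \sum_(j < N) mxpow T nu j i *: l j.
Proof.
elim: nu l i => [|k IH] l i.
  rewrite /= (bigD1 i)//= big1 => [|j ji]; rewrite mxE.
    by rewrite eqxx scale1r addr0.
  by rewrite (negbTE ji) scale0r.
rewrite iterS /mix_out.
transitivity (\sum_(j < N) \sum_(h < N) (mxpow T k h j * T j i) *: l h).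
  apply: eq_bigr => j _; rewrite IH scaler_sumr; apply: eq_bigr => h _.
  by rewrite scalerA mulrC.
rewrite exchange_big /=; apply: eq_bigr => h _; rewrite -scaler_suml.
by congr (_ *: _); rewrite mxE.
Qed.

Lemma mulmx_sigma_nu x i : Ahat *m sigma_nu T nu x i = A x i.
Proof.
by rewrite /sigma_nu /A_nu mulmx_sumr; apply: eq_bigr => j _; rewrite scalemxAr.
Qed.

Lemma vdot_mulmxT (v : 'cV[R]_m) (w : 'cV[R]_n) :
  vdot (Ahat^T *m v) w = vdot v (Ahat *m w).
Proof.
have vE p (y z : 'cV[R]_p) : vdot y z = (y^T *m z) 0 0.
  by rewrite mxE; apply: eq_bigr => j _; rewrite mxE.
by rewrite !vE trmx_mul trmxK mulmxA.
Qed.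

Lemma A_nu_adjoint (l : 'I_N -> 'cV[R]_m) (y : 'I_N -> 'cV[R]_n) :
  sdot (fun i => Ahat^T *m iter nu (mix_out T) l i) y = sdot l (A y).
Proof.
have vm := vdot_inner_product R m.
transitivity (\sum_(i < N) \sum_(j < N) mxpow T nu j i * vdot (l j) (Ahat *m y i)).
  apply: eq_bigr => i _; rewrite vdot_mulmxT mix_out_iter.
  rewrite (_ : vdot _ _ = \sum_(j < N) vdot (mxpow T nu j i *: l j) (Ahat *m y i)).
    by apply: eq_bigr => j _; rewrite (ipZl vm).
  by rewrite (big_morph (fun z => vdot z _) (fun a b => ipDl vm a b _) (ip0l vm _)).
rewrite exchange_big; apply: eq_bigr => j _ /=; rewrite /A_nu.
rewrite (big_morph (vdot (l j)) (fun a b => ipDr vm a b _) (ip0r vm _)).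
by apply: eq_bigr => i _; rewrite (ipZr vm).
Qed.

End Operators.

Lemma convex_set_segment (R : realType) n (X : set 'cV[R]_n) : convex_set X ->
  forall x y (t : R), X x -> X y -> 0 < t < 1 -> X (x + t *: (y - x)).
Proof.
move=> cX x y t Xx Xy /andP[t0 t1].
have t01 : Itv.spec (@Itv.num_sem R) (Itv.Real `[0%Z, 1%Z]) t.
  rewrite /= /Itv.num_sem /= num_real /= in_itv/=; apply/andP; split; exact: ltW.
have := cX y x (Itv.mk t01) (mem_set Xy) (mem_set Xx).
rewrite inE; congr X; transitivity (t *: y + (1 - t) *: x) => //.
by rewrite scalerBr scalerBl scale1r addrCA.
Qed.

(** * Variational inequalities *)

Section VariationalInequality.
Variables (R : realType) (N n : nat) (X : 'I_N -> set 'cV[R]_n).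
Variables (S : set ('I_N -> 'cV[R]_n)) (F : ('I_N -> 'cV[R]_n) -> 'I_N -> 'cV[R]_n).
Variables (alpha L : R).
Hypothesis cX : forall i, compact (X i).
Hypothesis SX : forall x, S x -> in_prod X x.
Hypothesis S0 : S !=set0.
Hypothesis S_closed : forall p, in_prod X p ->
  (forall e, 0 < e -> exists2 y, S y & snorm (ssub y p) < e) -> S p.
Hypothesis S_convex : forall x y (t : R), S x -> S y -> 0 < t < 1 -> S (x + t *: (y - x)).
Hypotheses (alpha0 : 0 < alpha) (L0 : 0 < L).
Hypothesis smon : forall x y, S x -> S y ->
  alpha * snorm (ssub x y) ^+ 2 <= sdot (ssub (F x) (F y)) (ssub x y).
Hypothesis Flip : forall x y, S x -> S y ->
  snorm (ssub (F x) (F y)) <= L * snorm (ssub x y).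
Local Notation sn := (sdot_inner_product R N n).
Local Notation nrm := (ipnorm (@sdot R N n)).

Lemma exists_projection z :
  exists p, S p /\ forall y, S y -> nrm (p - z) <= nrm (y - z).
Proof.
have [|p Sp hp] := @stacked_min _ _ _ X S (fun y => nrm (y - z)) 1 cX SX S0 S_closed.
  move=> x y _ _; rewrite mul1r lerBlDr.
  have -> : x - z = (x - y) + (y - z) by rewrite addrA subrK.
  exact: ler_ipnormD sn _ _.
by exists p.
Qed.

(* The natural residual |x - P(x - g F x)| attains its minimum on the compact set
   S; as P(id - g F) is a contraction, it decreases the residual unless it is 0. *)
Lemma strongly_monotone_VI_exists :
  exists2 p, S p & forall y, S y -> 0 <= sdot (F p) (y - p).
Proof.
have /choice[P hP] := exists_projection.
pose g := alpha / (L ^+ 2 + alpha ^+ 2).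
have D0 : 0 < L ^+ 2 + alpha ^+ 2 by rewrite addr_gt0 ?exprn_gt0.
have g0 : 0 < g by rewrite divr_gt0.
have ga1 : g * alpha < 1.
  by rewrite /g mulrAC -expr2 ltr_pdivrMr// mul1r ltrDr exprn_gt0.
have gL : g * L ^+ 2 <= alpha.
  by rewrite /g mulrAC ler_pdivrMr// ler_pM2l// lerDl sqr_ge0.
pose Q x := P (x - g *: F x).
have SQ x : S (Q x) by case: (hP (x - g *: F x)).
pose q := Num.sqrt (1 - g * alpha).
have q1 : q < 1.
  by rewrite -sqrtr1 ltr_sqrt// ltrBlDr ltrDl mulr_gt0.
have q0 : 0 <= q by exact: sqrtr_ge0.
have q2 : q ^+ 2 = 1 - g * alpha by rewrite sqr_sqrtr// subr_ge0 ltW.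
have Qq x y : S x -> S y -> nrm (Q x - Q y) <= q * nrm (x - y).
  move=> Sx Sy; have [S1 h1] := hP (x - g *: F x); have [S2 h2] := hP (y - g *: F y).
  apply: le_trans (proj_nonexpansive sn S_convex S1 h1 S2 h2) _.
  rewrite -(@ler_pXn2r _ 2) ?nnegrE ?mulr_ge0 ?ipnorm_ge0// exprMn q2.
  have -> : x - g *: F x - (y - g *: F y) = (x - y) + (- g) *: (F x - F y).
    rewrite scaleNr scalerBr !opprB -!addrA; congr (_ + _).
    by rewrite addrCA [RHS]addrCA; congr (_ + _); rewrite addrC.
  rewrite (sqr_ipnorm sn) (ip_sqrD sn) (ipZl sn) !(ipZr sn).
  have h3 : alpha * nrm (x - y) ^+ 2 <= sdot (F x - F y) (x - y) := smon Sx Sy.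
  have h4 : nrm (F x - F y) ^+ 2 <= L ^+ 2 * nrm (x - y) ^+ 2.
    rewrite -exprMn ler_pXn2r ?nnegrE ?mulr_ge0 ?ipnorm_ge0 ?(ltW L0)//; exact: Flip.
  have h5 := ler_wpM2l (ltW g0) h3.
  have h6 := ler_wpM2l (sqr_ge0 g) h4.
  have h7 := ler_wpM2r (sqr_ge0 (nrm (x - y))) (ler_wpM2l (ltW g0) gL).
  rewrite (ipC sn (x - y) (F x - F y)) -!(sqr_ipnorm sn).
  lra.
have [|p Sp hp] := @stacked_min _ _ _ X S (fun y => nrm (y - Q y)) 2 cX SX S0 S_closed.
  move=> x y Sx Sy; rewrite lerBlDr.
  have -> : x - Q x = (x - y) + (y - Q y) + (Q y - Q x).
    by rewrite !subrKA.
  apply: le_trans (ler_ipnormD sn _ _) _.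
  apply: le_trans (lerD (ler_ipnormD sn _ _) (lexx _)) _.
  have := Qq y x Sy Sx; rewrite (ipnormB sn y x) snormE ssubE.
  have := ler_wpM2r (ipnorm_ge0 (@sdot R N n) (x - y)) (ltW q1).
  lra.
have pQ : p - Q p = 0.
  apply: snorm_eq0; apply/eqP; rewrite eq_le sqrtr_ge0 andbT leNgt; apply/negP => r0.
  have := le_trans (hp _ (SQ p)) (Qq _ _ Sp (SQ p)).
  by rewrite -[X in X <= _]mul1r (ler_pM2r r0) leNgt q1.
exists p => // y Sy.
have [S1 h1] := hP (p - g *: F p).
have := proj_variational sn S_convex S1 h1 Sy.
rewrite -/(Q p) -(subr0_eq pQ) subKr (ipZl sn).
by rewrite pmulr_rge0.
Qed.

Lemma strongly_monotone_VI_unique p p' : S p -> S p' ->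
  (forall y, S y -> 0 <= sdot (F p) (y - p)) ->
  (forall y, S y -> 0 <= sdot (F p') (y - p')) -> p' = p.
Proof.
move=> Sp Sp' /(_ _ Sp') h /(_ _ Sp) h'; apply: subr0_eq; apply: snorm_eq0.
have := smon Sp' Sp; rewrite !ssubE => hm.
have : alpha * snorm (p' - p) ^+ 2 <= 0.
  apply: le_trans hm _; rewrite (ipBl sn).
  by move: h'; rewrite -opprB (ipNr sn); lra.
rewrite pmulr_rle0// => hh; apply/eqP; rewrite -(sqrf_eq0 (snorm _)).
by rewrite eq_le hh sqr_ge0.
Qed.

End VariationalInequality.

Section Feasible.
Variables (R : realType) (N n m : nat) (X : 'I_N -> set 'cV[R]_n).
Variables (T : 'M[R]_N) (nu : nat) (Ahat : 'M[R]_(m, n)) (bhat : 'cV[R]_m).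
Hypothesis cX : forall i, compact (X i).
Local Notation A := (@A_nu R N n m T nu Ahat).
Local Notation Q := (Q_nu X T nu Ahat bhat).
Local Notation sn := (sdot_inner_product R N n).
Local Notation sm := (sdot_inner_product R N m).
Local Notation b := ((fun _ => bhat) : 'I_N -> 'cV[R]_m).

Let A_coord_le x y i k :
  A x i k 0 - A y i k 0 <= A_nu_norm T nu Ahat * snorm (ssub x y).
Proof.
have -> : A x i k 0 - A y i k 0 = A (ssub x y) i k 0.
  by rewrite ssubE A_nuB; rewrite [in RHS]/= !mxE.
apply: le_trans (ler_norm _) _; apply: le_trans (coord_le_vnorm _ _) _.
exact: le_trans (vnorm_le_snorm _ _) (A_nu_norm_le _ _ _ _).
Qed.

Lemma Q_nu_closed p : in_prod X p ->
  (forall e, 0 < e -> exists2 y, Q y & snorm (ssub y p) < e) -> Q p.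
Proof.
move=> Xp hp; split=> // i k; apply/ler_addgt0Pr => e e0.
pose a := A_nu_norm T nu Ahat + 1.
have a0 : 0 < a by rewrite ltr_wpDl ?A_nu_norm_ge0.
have [|y [_ Qy] yp] := hp (e / a); first by rewrite divr_gt0.
have h1 := A_coord_le p y i k; have h2 := Qy i k.
have h3 : snorm (ssub p y) = snorm (ssub y p).
  by rewrite !snormE !ssubE (ipnormB sn).
have h4 : a * snorm (ssub y p) <= e by rewrite mulrC -ler_pdivlMr// ltW.
have h5 : 0 <= snorm (ssub y p) by exact: sqrtr_ge0.
by move: h1 h4; rewrite h3 /a; lra.
Qed.

Lemma in_prod_segment x y (t : R) : (forall i, convex_set (X i)) ->
  in_prod X x -> in_prod X y -> 0 < t < 1 -> in_prod X (x + t *: (y - x)).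
Proof. by move=> cvX Xx Xy t01 i; exact: convex_set_segment. Qed.

Lemma Q_nu_segment x y (t : R) : (forall i, convex_set (X i)) ->
  Q x -> Q y -> 0 < t < 1 -> Q (x + t *: (y - x)).
Proof.
move=> cvX [Xx hx] [Xy hy] t01; split; first exact: in_prod_segment.
move=> i k; have := hx i k; have := hy i k.
rewrite addrC A_nuZD A_nuB.
have -> : (t *: (A y - A x) + A x) i k 0 = t * (A y i k 0 - A x i k 0) + A x i k 0.
  by transitivity ((t *: (A y i - A x i) + A x i) k 0) => //; rewrite !mxE.
case/andP: t01 => t0 t1 hy' hx'.
have := ler_wpM2l (ltW t0) hy'; have t1' : 0 <= 1 - t by rewrite subr_ge0 ltW.
by have := ler_wpM2l t1' hx'; lra.
Qed.

(* The total constraint violation attains a positive minimum on the compact set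
   of the y in X with sdot c (y - xb) <= - e. *)
Lemma VI_almost_feasible (c xb : 'I_N -> 'cV[R]_n) :
  (forall x, Q x -> 0 <= sdot c (ssub x xb)) ->
  forall e, 0 < e -> exists2 d, 0 < d &
    forall y (r : 'I_N -> 'cV[R]_m), in_prod X y -> snorm r <= d ->
    (forall z, (forall i, nonneg_orthant (z i)) -> 0 <= sdot z (r - (A y - b))) ->
    - e <= sdot c (ssub y xb).
Proof.
move=> hc e e0.
pose S : set ('I_N -> 'cV[R]_n) := [set y | in_prod X y /\ sdot c (y - xb) <= - e].
have [S0|S0] := pselect (S !=set0); last first.
  exists 1 => // y r Xy _ _; rewrite leNgt; apply/negP => h; apply: S0; exists y.
  by split=> //; exact: ltW.
pose h (y : 'I_N -> 'cV[R]_n) :=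
  \sum_(i < N) \sum_(k < m) Num.max 0 (A y i k 0 - bhat k 0).
have S_closed p : in_prod X p ->
    (forall d, 0 < d -> exists2 y, S y & snorm (ssub y p) < d) -> S p.
  move=> Xp hp; split=> //; apply/ler_addgt0Pr => d d0.
  have n0 : 0 < snorm c + 1 by rewrite ltr_wpDl ?sqrtr_ge0.
  have [|y [_ Sy] yp] := hp (d / (snorm c + 1)); first by rewrite divr_gt0.
  have h1 := ip_cauchyN sn c (y - p).
  have h2 : (snorm c + 1) * snorm (ssub y p) <= d by rewrite mulrC -ler_pdivlMr// ltW.
  have h3 : 0 <= snorm (ssub y p) by exact: sqrtr_ge0.
  have h4 : sdot c (p - xb) = sdot c (y - xb) - sdot c (y - p).
    by rewrite -(ipBr sn); congr (sdot c); rewrite opprB [RHS]addrC subrKA.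
  by move: h1 h2 h3; rewrite !snormE !ssubE h4; lra.
have h_lip x y : S x -> S y ->
    h x - h y <= (N * m)%:R * A_nu_norm T nu Ahat * snorm (ssub x y).
  move=> _ _; rewrite /h -sumrB natrM -2!mulrA mulr_natl -[N in _ *+ N]card_ord -sumr_const.
  apply: ler_sum => i _; rewrite -sumrB mulr_natl -[m in _ *+ m]card_ord -sumr_const.
  apply: ler_sum => k _; have := A_coord_le x y i k.
  have : 0 <= A_nu_norm T nu Ahat * snorm (ssub x y).
    by rewrite mulr_ge0 ?A_nu_norm_ge0 ?sqrtr_ge0.
  by rewrite /Num.max; case: ltP => ?; case: ltP => ?; lra.
have [|p Sp hp] := @stacked_min _ _ _ X S h _ cX _ S0 S_closed h_lip; first by move=> x [].
have term_ge0 y i k : 0 <= Num.max 0 (A y i k 0 - bhat k 0) by rewrite le_max lexx.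
have hp0 : 0 < h p.
  rewrite ltNge; apply/negP => hp0; have [Xp cp] := Sp.
  suff /hc : Q p by rewrite ssubE; lra.
  split=> // i k; rewrite leNgt; apply/negP => viol.
  have : 0 < h p; last by rewrite ltNge hp0.
  rewrite /h (bigD1 i)//= ltr_wpDr//; first by do 2 apply: sumr_ge0 => ? _.
  rewrite (bigD1 k)//= ltr_wpDr//; first by apply: sumr_ge0 => ? _.
  by rewrite lt_max subr_gt0 viol orbT.
pose d := h p / (N * m).+1%:R.
have d0 : 0 < d by rewrite divr_gt0.
exists d => // y r Xy rd hr; rewrite leNgt; apply/negP => hy.
have := hp y (conj Xy (ltW hy)); apply/negP; rewrite -ltNge.
apply: (@le_lt_trans _ _ ((N * m)%:R * d)); last first.
  by rewrite /d mulrCA gtr_pMr// ltr_pdivrMr// mul1r ltr_nat.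
rewrite /h natrM -mulrA mulr_natl -[N in _ *+ N]card_ord -sumr_const.
apply: ler_sum => i _; rewrite mulr_natl -[m in _ *+ m]card_ord -sumr_const.
apply: ler_sum => k _; rewrite ge_max (ltW d0) /=.
pose z : 'I_N -> 'cV[R]_m := fun j => (j == i)%:R *: delta_mx k 0.
have zge j : nonneg_orthant (z j).
  by move=> l; rewrite !mxE mulr_ge0// ler0n.
have sz w : sdot z w = w i k 0.
  rewrite /sdot (bigD1 i)//= big1 => [|j /negbTE ji]; last first.
    by rewrite /z ji (ipZl (vdot_inner_product R m)) mul0r.
  rewrite addr0 /z eqxx scale1r /vdot (bigD1 k)//= big1 => [|l /negbTE lk].
    by rewrite mxE !eqxx mul1r addr0.
  by rewrite mxE lk mul0r.
have := hr z zge; rewrite sz.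
have -> : (r - (A y - b)) i k 0 = r i k 0 - (A y i k 0 - bhat k 0).
  by transitivity ((r i - (A y i - bhat)) k 0) => //; rewrite !mxE.
have r1 : r i k 0 <= d.
  apply: le_trans (ler_norm _) _; apply: le_trans (coord_le_vnorm _ _) _.
  exact: le_trans (vnorm_le_snorm _ _) rd.
by lra.
Qed.

End Feasible.

Lemma step_size_quadratic (R : realType) (alpha L tau a : R) :
  0 < alpha -> 0 < tau -> 0 <= a ->
  tau < (- L ^+ 2 + Num.sqrt (L ^+ 4 + 4%:R * alpha ^+ 2 * a ^+ 2))
        / (2%:R * alpha * a ^+ 2) ->
  tau * (alpha * a ^+ 2 * tau + L ^+ 2) < alpha.
Proof.
move=> al0 t0 a0; have [->|an0] := eqVneq a 0.
  by rewrite expr0n /= !mulr0 invr0 mulr0 => /(lt_trans t0); rewrite ltxx.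
have a1 : 0 < a by rewrite lt_neqAle eq_sym an0.
have d0 : 0 < 2 * alpha * a ^+ 2 by rewrite !mulr_gt0 ?exprn_gt0.
rewrite ltr_pdivlMr// addrC ltrBrDr => h.
have s0 : 0 <= L ^+ 4 + 4 * alpha ^+ 2 * a ^+ 2.
  have -> : L ^+ 4 = (L ^+ 2) ^+ 2 by rewrite -exprM.
  by apply: addr_ge0; [exact: sqr_ge0 | by have alW := ltW al0; rewrite !mulr_ge0].
have l0 : 0 <= tau * (2 * alpha * a ^+ 2) + L ^+ 2.
  by apply: addr_ge0; [apply: mulr_ge0; exact: ltW | exact: sqr_ge0].
have : (tau * (2 * alpha * a ^+ 2) + L ^+ 2) ^+ 2 < L ^+ 4 + 4 * alpha ^+ 2 * a ^+ 2.
  by rewrite -[ltRHS]sqr_sqrtr// ltr_pXn2r// nnegrE ?sqrtr_ge0.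
have c0 : 0 < 4 * alpha * a ^+ 2 by rewrite !mulr_gt0 ?exprn_gt0.
move=> hh; rewrite -(ltr_pM2l c0).
have L4 : L ^+ 4 = L ^+ 2 * L ^+ 2 by rewrite -exprD.
by move: hh; rewrite L4; lra.
Qed.

Lemma nonneg_orthant_segment (R : realType) m (x y : 'cV[R]_m) (t : R) :
  nonneg_orthant x -> nonneg_orthant y -> 0 < t < 1 -> nonneg_orthant (x + t *: (y - x)).
Proof.
move=> hx hy /andP[t0 t1] k; have := hx k; have := hy k; rewrite !mxE => y0 x0.
have t1' : 0 <= 1 - t by rewrite subr_ge0 ltW.
by have := mulr_ge0 (ltW t0) y0; have := mulr_ge0 t1' x0; lra.
Qed.

Theorem theorem3 (R : realType) (N n m : nat) (HN : (0 < N)%N) (Hn : (0 < n)%N)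
    (Hm : (0 < m)%N)
    (X : 'I_N -> set 'cV[R]_n)
    (HXconv : forall i, convex_set (X i))
    (HXcomp : forall i, compact (X i))
    (HXint : forall i, exists z, (X i)^° z)
    (J : 'I_N -> 'cV[R]_n -> 'cV[R]_n -> R)
    (g1 g2 : 'I_N -> 'cV[R]_n -> 'cV[R]_n -> 'cV[R]_n)
    (HJC1 : forall i, C1_on_with_grads
              [set z | X i z.1 /\ conv_hull X z.2] (J i) (g1 i) (g2 i))
    (HJconv : forall (i : 'I_N) (x : 'I_N -> 'cV[R]_n), in_prod X x ->
       forall (y1 y2 : 'cV[R]_n) (t : R), X i y1 -> X i y2 -> 0 <= t -> t <= 1 ->
       let upd y := fun j => if j == i then y else x j in
       let obj y := J i y (N%:R^-1 *: \sum_(j < N) upd y j) in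
       obj (t *: y1 + (1 - t) *: y2) <= t * obj y1 + (1 - t) * obj y2)
    (Ahat : 'M[R]_(m, n)) (bhat : 'cV[R]_m)
    (T : 'M[R]_N) (HT : forall i j, 0 <= T i j <= 1)
    (nu : nat)
    (HQ : exists x, Q_nu X T nu Ahat bhat x)
    (alpha L : R) (Halpha : 0 < alpha) (HL : 0 < L)
    (Hsmon : forall x y, in_prod X x -> in_prod X y ->
       sdot (ssub (F_nu T nu g1 g2 x) (F_nu T nu g1 g2 y)) (ssub x y)
         >= alpha * snorm (ssub x y) ^+ 2)
    (HLip : forall x y, in_prod X x -> in_prod X y ->
       snorm (ssub (F_nu T nu g1 g2 x) (F_nu T nu g1 g2 y)) <= L * snorm (ssub x y))
    (tau : R) (Htau0 : 0 < tau)
    (Htau : tau < (- L ^+ 2 + Num.sqrt (L ^+ 4 + 4%:R * alpha ^+ 2 * A_nu_norm T nu Ahat ^+ 2))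
                  / (2%:R * alpha * A_nu_norm T nu Ahat ^+ 2)) :
  exists xb : 'I_N -> 'cV[R]_n,
    is_VNE X T nu Ahat bhat g1 g2 xb /\
    (forall xb', is_VNE X T nu Ahat bhat g1 g2 xb' -> xb' = xb) /\
    forall (x : nat -> 'I_N -> 'cV[R]_n) (lam : nat -> 'I_N -> 'cV[R]_m),
      in_prod X (x 0%N) -> (forall i, nonneg_orthant (lam 0%N i)) ->
      Alg1_run X T nu Ahat bhat g1 g2 tau x lam ->
      forall e : R, 0 < e -> exists K : nat, forall k : nat, (K <= k)%N ->
        snorm (ssub (x k) xb) < e.

Proof.
pose A := @A_nu R N n m T nu Ahat.
pose F := F_nu T nu g1 g2.
pose b : 'I_N -> 'cV[R]_m := fun=> bhat.
pose a := A_nu_norm T nu Ahat.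
have sn := sdot_inner_product R N n; have sm := sdot_inner_product R N m.
have a0 : 0 <= a by exact: A_nu_norm_ge0.
have step_size : tau * (alpha * a ^+ 2 * tau + L ^+ 2) < alpha.
  exact: step_size_quadratic.
have cvQ x y (t : R) := @Q_nu_segment R N n m X T nu Ahat bhat x y t HXconv.
have clQ := @Q_nu_closed R N n m X T nu Ahat bhat.
have QX x : Q_nu X T nu Ahat bhat x -> in_prod X x by case.
have QF x y : Q_nu X T nu Ahat bhat x -> Q_nu X T nu Ahat bhat y ->
    alpha * snorm (ssub x y) ^+ 2 <= sdot (ssub (F x) (F y)) (ssub x y).
  by move=> /QX Xx /QX Xy; exact: Hsmon.
have QL x y : Q_nu X T nu Ahat bhat x -> Q_nu X T nu Ahat bhat y ->
    snorm (ssub (F x) (F y)) <= L * snorm (ssub x y).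
  by move=> /QX Xx /QX Xy; exact: HLip.
have [xb Qxb xbP] := strongly_monotone_VI_exists HXcomp QX HQ clQ cvQ Halpha HL QF QL.
exists xb; split; first by split.
split=> [xb' [Qxb' xbP']|x l Xx0 l0 run].
  exact: (strongly_monotone_VI_unique Halpha QF Qxb Qxb' xbP xbP').
have Xxb := QX _ Qxb.
have [|p Xp hp] := @stacked_min R N n X [set x | in_prod X x]
    (fun y => - snorm (ssub y xb)) 1 HXcomp (fun x Xx => Xx)
    (ex_intro _ xb Xxb) (fun p Xp _ => Xp).
  move=> y z _ _; rewrite mul1r opprK addrC lerBlDr.
  have := ler_ipnormD sn (z - y) (y - xb).
  by rewrite subrKA (ipnormB sn z y).
pose X' := [set y | in_prod X y] : set ('I_N -> 'cV[R]_n).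
pose Wp := [set z | forall i, nonneg_orthant (z i)] : set ('I_N -> 'cV[R]_m).
have Xx k : in_prod X (x k) by case: k => // k i; case: (run k i) => -[].
have Wl k : Wp (l k) by case: k => // k i; case: (run k i) => _ [].
have sigmaE k : alg_sigma T nu x k.+1 = sigma_nu T nu (x k.+1).
  exact: sigma_nu_iter.
have cvg : forall e, 0 < e -> exists K, forall k, (K <= k)%N ->
    snorm (x k.+1 - xb) < e.
  apply: (@primal_dual_cvg R _ _ (@sdot R N n) (@sdot R N m) sn sm X' Wp A b F
    a alpha L tau (snorm (ssub p xb)) xb (fun k => x k.+1) (fun k => l k.+1)) => //.
  - exact: A_nuB.
  - exact: A_nu_norm_le.
  - by move=> y Xy; rewrite -lerN2; exact: hp.
  - by move=> i k; exact: lexx.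
  - move=> y z Wy Wz i k; have := Wy i k; have := Wz i k.
    by rewrite (_ : (y + z) i = y i + z i)// !mxE => z0 y0; exact: addr_ge0.
  - move=> z Wz; apply: sumr_ge0 => i _; apply: sumr_ge0 => k _.
    rewrite mulr_ge0//; first by have := Wz i k; rewrite mxE.
    have -> : (b - A xb) i k 0 = bhat k 0 - A xb i k 0.
      by transitivity ((bhat - A xb i) k 0) => //; rewrite !mxE.
    by rewrite subr_ge0; case: Qxb => _; apply.
  - move=> e /(VI_almost_feasible HXcomp xbP)[d d0 hd].
    by exists d => // y r Xy rd hr; exact: hd Xy rd hr.
  - by move=> k; exact: Xx.
  - move=> k y Xy; rewrite -A_nu_adjoint.
    set G := fun i => _; set z := y - x k.+2.
    rewrite -(ipDl sn) -(ipZl sn) -(ipDl sn); apply: sumr_ge0 => i _.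
    have [[Xi hi] _] := run k.+1 i.
    have := proj_variational (vdot_inner_product R n) (convex_set_segment (HXconv i))
      Xi hi (Xy i).
    rewrite sigmaE; congr (0 <= vdot _ _).
    by rewrite opprB addrA addrAC.
  - move=> k y Wy; rewrite -mulNr -(ipZl sm) -(ipDl sm); apply: sumr_ge0 => i _.
    have [_ [Wi hi]] := run k.+1 i.
    have := proj_variational (vdot_inner_product R m) (@nonneg_orthant_segment R m)
      Wi hi (Wy i).
    rewrite !sigmaE !mulmx_sigma_nu.
    congr (0 <= vdot _ _).
    transitivity (l k.+2 i - l k.+1 i +
      (- tau) *: (A (x k.+2) i - bhat + A (x k.+2 - x k.+1) i)) => //.
    rewrite opprB addrA addrAC; congr (_ + _).
    rewrite /A A_nuB scaleNr -scalerN; congr (_ *: _).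
    rewrite (_ : (A_nu T nu Ahat (x k.+2) - A_nu T nu Ahat (x k.+1)) i =
      A (x k.+2) i - A (x k.+1) i)// -/A.
    by apply/colP => j; rewrite !mxE; ring.
move=> e /cvg[K hK]; exists K.+1 => -[//|k] Kk; exact: hK.
Qed.
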